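(* Assume that $\dim_k V_i=m$ for all $i=1,\dots,d$. (a) Every tensor $T\in S^{\nu_1}V_1\otimes\dots\otimes S^{\nu_d}V_d$ of border rank $m$ is a restriction of a minimal border rank tensor $\widetilde{T}\in S^{\nu_1}V_1\otimes\dots\otimes S^{\nu_d}V_d$. (b) Moreover, given a degeneration of concise rank $m$ tensors $T_t$ witnessing the border rank of $T$ (that is, $T_{t=0}=T$ and the general tensor $T_{t\neq0}$ is concise of rank $m$), one can explicitly construct from $T_t$ a minimal border rank tensor $\widetilde{T}$ of which $T$ is a restriction.
   Context: $k$ is a field of characteristic zero or characteristic greater than all of the positive integers $\nu_1,\dots,\nu_d$; $V_1,\dots,V_d$ are finite-dimensional $k$-vector spaces. Write $S:=S^{\nu_1}V_1\otimes\dots\otimes S^{\nu_d}V_d$ (partially symmetric tensors; this includes the symmetric case $d=1$ and the case of ordinary tensors, all $\nu_i=1$). The rank of $T\in S$ is the least number of summands in an expression of $T$ as a sum of elements of the form $c\,\ell_1^{\nu_1}\otimes\dots\otimes\ell_d^{\nu_d}$, with $c$ a scalar and $\ell_i\in V_i$. A degeneration of tensors to $T$ is an element $T_t\in S[\![t]\!]=S\otimes k[\![t]\!]$ with $T_{t=0}=T$; its general tensor $T_{t\ne0}$ is $T_t$ viewed as an element of the $k(\!(t)\!)$-vector space $S(\!(t)\!)$ (so rank, conciseness, etc. of $T_{t\neq0}$ are taken over $k(\!(t)\!)$). The border rank of $T$ is the least $r$ such that $T$ is the limit at $t=0$ of a degeneration whose general tensor has rank at most $r$. $T\in S$ is concise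 if it does not lie in any proper subspace of the form $S^{\nu_1}V_1'\otimes\dots\otimes S^{\nu_d}V_d'$ with $V_i'\subseteq V_i$. A minimal border rank tensor (when all $\dim V_i=m$) is a concise tensor of border rank $m$. $T$ is a restriction of $\widetilde{T}$ (equivalently, $\widetilde{T}$ is an unrestriction of $T$) if there are linear maps $\varphi_i\colon V_i\to V_i$ such that the induced map $S\to S$ sends $\widetilde{T}$ to $T$. *)

(* Defs.v *)
From HB Require Import structures.
From mathcomp Require Import all_boot all_order all_algebra.
From mathcomp.classical Require Import boolp.
From mathcomp.multinomials Require Import mpoly.

Set Implicit Arguments.
Unset Strict Implicit.
Unset Printing Implicit Defensive.

Import Order.TTheory GRing.Theory Num.Theory.
Local Open Scope ring_scope.

Record pseries (R : Type) := PSeries { pscoef :> nat -> R }.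

Section PowerSeriesRing.
Variable R : comNzRingType.
Implicit Types f g h : pseries R.

Lemma pseriesP f g : (forall n, f n = g n) -> f = g.
Proof. by case: f g => [f] [g] /= fg; congr PSeries; apply/funext. Qed.

Lemma pscoefK : cancel (@pscoef R) (@PSeries R).
Proof. by case. Qed.

HB.instance Definition _ := Choice.copy (pseries R) (can_type pscoefK).

Definition ps_const (c : R) := PSeries (fun n => if n is 0 then c else 0).
Definition ps_opp f := PSeries (fun n => - f n).
Definition ps_add f g := PSeries (fun n => f n + g n).
Definition ps_mul f g := PSeries (fun n => \sum_(i < n.+1) f i * g (n - i)%N).

Lemma ps_addA : associative ps_add.
Proof. by move=> f g h; apply/pseriesP => n /=; rewrite addrA. Qed.

Lemma ps_addC : commutative ps_add.
Proof. by move=> f g; apply/pseriesP => n /=; rewrite addrC. Qed.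

Lemma ps_add0 : left_id (ps_const 0) ps_add.
Proof. by move=> f; apply/pseriesP => -[|n] /=; rewrite add0r. Qed.

Lemma ps_addN : left_inverse (ps_const 0) ps_opp ps_add.
Proof. by move=> f; apply/pseriesP => -[|n] /=; rewrite addNr. Qed.

HB.instance Definition _ :=
  GRing.isZmodule.Build (pseries R) ps_addA ps_addC ps_add0 ps_addN.

Let trunc N f : {poly R} := \poly_(i < N) f i.

Lemma ps_mulE N f g n : (n < N)%N -> ps_mul f g n = (trunc N f * trunc N g)`_n.
Proof.
move=> nN; rewrite coefM /=; apply: eq_bigr => i _.
rewrite !coef_poly (leq_ltn_trans (leq_subr i n) nN).
by rewrite (leq_ltn_trans _ nN) // -ltnS.
Qed.

Lemma ps_mulC : commutative ps_mul.
Proof. by move=> f g; apply/pseriesP => n; rewrite !(@ps_mulE n.+1) // mulrC. Qed.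

Lemma ps_mulA : associative ps_mul.
Proof.
have aux f g h n :
    ps_mul f (ps_mul g h) n = (trunc n.+1 f * (trunc n.+1 g * trunc n.+1 h))`_n.
  rewrite coefM; apply: eq_bigr => i _.
  by rewrite coef_poly ltn_ord -(@ps_mulE n.+1) // ltnS leq_subr.
move=> f g h; apply/pseriesP => n; rewrite aux ps_mulC aux.
by rewrite mulrA mulrC.
Qed.

Lemma ps_mul1 : left_id (ps_const 1) ps_mul.
Proof.
move=> f; apply/pseriesP => n /=; rewrite big_ord_recl /= mul1r subn0.
by rewrite big1 ?addr0 // => i _; rewrite mul0r.
Qed.

Lemma ps_mulDl : left_distributive ps_mul ps_add.
Proof.
move=> f g h; apply/pseriesP => n /=; rewrite -big_split /=.
by apply: eq_bigr => i _; rewrite mulrDl.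
Qed.

Lemma ps_one_neq0 : ps_const 1 != 0.
Proof.
by apply/eqP => /(congr1 (fun f : pseries R => f 0%N)) /eqP; rewrite oner_eq0.
Qed.

HB.instance Definition _ := GRing.Zmodule_isComNzRing.Build (pseries R)
  ps_mulA ps_mulC ps_mul1 ps_mulDl ps_one_neq0.

Definition ps_unit : {pred pseries R} := fun f => `[< exists g, g * f = 1 >].
Definition ps_inv f : pseries R :=
  if pselect (exists g, g * f = 1) is left e then projT1 (cid e) else f.

Lemma ps_mulVf : {in ps_unit, left_inverse 1 ps_inv *%R}.
Proof.
move=> f /asboolP e; rewrite /ps_inv; case: pselect => // e'.
by case: (cid e').
Qed.

Lemma ps_unitP f g : g * f = 1 -> ps_unit f.
Proof. by move=> e; apply/asboolP; exists g. Qed.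

Lemma ps_inv_out : {in [predC ps_unit], ps_inv =1 id}.
Proof.
by move=> f /asboolP e; rewrite /ps_inv; case: pselect => // e'; case: e.
Qed.

HB.instance Definition _ := GRing.ComNzRing_hasMulInverse.Build (pseries R)
  ps_mulVf ps_unitP ps_inv_out.

(* The t-adic valuation, with the convention that it is 0 at f = 0. *)
Definition psval f : nat :=
  if pselect (exists n, f n != 0) is left e then ex_minn e else 0.

(* Division by t ^ c (the terms of order < c are dropped). *)
Definition ps_shift (c : nat) f : pseries R := PSeries (fun n => f (n + c)%N).

(* The substitution t := t ^ e, for e > 0. *)
Definition ps_ramify (e : nat) f : pseries R :=
  PSeries (fun n => if (e %| n)%N then f (n %/ e)%N else 0).

End PowerSeriesRing.

Section PowerSeriesDomain.
Variable R : idomainType.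

Lemma ps_integral : GRing.integral_domain_axiom (pseries R).
Proof.
move=> f g fg0; apply/negP => /negP; rewrite negb_or => /andP[f0 g0]; move: fg0.
have ex (h : pseries R) : h != 0 -> exists n, h n != 0.
  move=> h0; apply: contrapT => e; case/eqP: h0; apply/pseriesP => n.
  transitivity (0 : R); last by case: n.
  by have [//|hn] := eqVneq (h n) 0; case: e; exists n.
case: (ex_minnP (ex f f0)) => a fa mina; case: (ex_minnP (ex g g0)) => b gb minb.
move=> /(congr1 (fun f : pseries R => f (a + b)%N)).
have -> : (0 : pseries R) (a + b)%N = 0 :> R by case: (a + b)%N.
have la : (a < (a + b).+1)%N by rewrite ltnS leq_addr.
rewrite /= (bigD1 (Ordinal la)) //= addKn big1 ?addr0.
  by apply/eqP; rewrite mulf_neq0.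
move=> i; rewrite -val_eqE /= => ia; case: (ltngtP i a) ia => // ia _.
  have [->|/mina] := eqVneq (f i) 0; first by rewrite mul0r.
  by rewrite leqNgt ia.
have [->|/minb] := eqVneq (g (a + b - i)%N) 0; first by rewrite mulr0.
by rewrite leqNgt ltn_subLR ?ltn_add2r ?ia // -ltnS ltn_ord.
Qed.

HB.instance Definition _ :=
  GRing.ComUnitRing_isIntegral.Build (pseries R) ps_integral.

End PowerSeriesDomain.

(* k((t)) is obtained as the fraction field of k[[t]]. *)
Notation laurent k := {fraction (pseries k)}.

(* Coordinates are chosen so that V_i = R^m, with row vectors as elements. The  *)
(* variable x_(i, j) is the j-th basis vector of V_i, {mpoly R[nvars d m]} is   *)
(* Sym(V_1) (x) ... (x) Sym(V_d), and S^(nu_1) V_1 (x) ... (x) S^(nu_d) V_d is   *)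
(* its component of multidegree nu.                                             *)

Notation nvars d m := #|{: 'I_d * 'I_m}|.
Notation tensor R d m := {mpoly R[nvars d m]}.

Definition vx d m (i : 'I_d) (j : 'I_m) : 'I_(nvars d m) := enum_rank (i, j).

Section Tensors.
Variables (R : comNzRingType) (d m : nat) (nu : 'I_d -> nat).

Definition pstensor : {pred tensor R d m} := fun T =>
  all (fun a : 'X_{1..(nvars d m)} =>
         [forall i : 'I_d, (\sum_(j < m) a (vx i j))%N == nu i]) (msupp T).

Definition lin (i : 'I_d) (v : 'rV[R]_m) : tensor R d m :=
  \sum_(j < m) v 0 j *: 'X_(vx i j).

Definition rank_le (r : nat) (T : tensor R d m) : Prop :=
  exists (c : 'I_r -> R) (l : 'I_r -> 'I_d -> 'rV[R]_m),
    T = \sum_(s < r) c s *: \prod_(i < d) lin i (l s i) ^+ nu i.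

Definition has_rank (T : tensor R d m) (r : nat) : Prop :=
  rank_le r T /\ forall r', rank_le r' T -> (r <= r')%N.

(* The map induced by the v |-> v *m phi i: it replaces each basis vector       *)
(* x_(i, j) by its image.                                                       *)
Definition induced (phi : 'I_d -> 'M[R]_m) (T : tensor R d m) : tensor R d m :=
  T \mPo [tuple lin (enum_val a).1 (row (enum_val a).2 (phi (enum_val a).1))
          | a < nvars d m].

Definition is_restriction (T T' : tensor R d m) : Prop :=
  exists phi : 'I_d -> 'M[R]_m, induced phi T' = T.

End Tensors.

Section Concise.
Variables (F : fieldType) (d m : nat) (nu : 'I_d -> nat).

(* T lies in S^(nu_1) W_1 (x) ... (x) S^(nu_d) W_d, which is spanned by the      *)
(* products of nu_1 vectors of W_1, ..., nu_d vectors of W_d.                   *)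
Definition in_subtensor (W : 'I_d -> {vspace 'rV[F]_m}) (T : tensor F d m) :
    Prop :=
  exists (r : nat) (c : 'I_r -> F)
         (w : 'I_r -> forall i : 'I_d, 'I_(nu i) -> 'rV[F]_m),
    (forall s i a, w s i a \in W i) /\
    T = \sum_(s < r) c s *: \prod_(i < d) \prod_(a < nu i) lin i (w s i a).

Definition proper_subtensor (W : 'I_d -> {vspace 'rV[F]_m}) : Prop :=
  exists2 T : tensor F d m, T \in pstensor nu & ~ in_subtensor W T.

Definition concise (T : tensor F d m) : Prop :=
  forall W, proper_subtensor W -> ~ in_subtensor W T.

End Concise.

Section Degenerations.
Variables (k : fieldType) (d m : nat) (nu : 'I_d -> nat).

Definition limit : tensor (pseries k) d m -> tensor k d m :=
  map_mpoly (fun f : pseries k => f 0%N).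

Definition general : tensor (pseries k) d m -> tensor (laurent k) d m :=
  map_mpoly (@tofrac (pseries k)).

Definition border_rank_le (r : nat) (T : tensor k d m) : Prop :=
  exists Tt : tensor (pseries k) d m,
    [/\ Tt \in pstensor nu, limit Tt = T & rank_le nu r (general Tt)].

Definition has_border_rank (T : tensor k d m) (r : nat) : Prop :=
  border_rank_le r T /\ forall r', border_rank_le r' T -> (r <= r')%N.

Definition minimal_border_rank (T : tensor k d m) : Prop :=
  concise nu T /\ has_border_rank T m.

(* The explicit construction of an unrestriction of the limit. One step, from a *)
(* degeneration Tt, goes as follows.                                            *)
(* - Let W_i be the smallest subspace of V_i such that limit Tt lies in the     *)
(*   tensor product of the S^(nu_i) W_i; it is spanned by the derivatives of    *)
(*   order (nu_1 + ... + nu_d) - 1 that are linear in the variables x_(i, _).   *)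
(* - Write Tt in bases of the V_i extending bases of the W_i. Every coefficient *)
(*   of a monomial involving the complementary basis vectors vanishes at t = 0. *)
(* - Let b = c / e >= 0, in lowest terms, be the largest slope such that all    *)
(*   coefficients remain power series in t ^ (1 / e) when the complementary     *)
(*   basis vectors are multiplied by t ^ (- b). Put t := t ^ e and perform this *)
(*   rescaling.                                                                 *)
(* The limit of the result restricts to limit Tt by the projections V_i -> W_i  *)
(* if b > 0. If limit Tt is concise, then b = 0 and Tt is unchanged.            *)

Definition span_mx (T : tensor k d m) (i : 'I_d) : 'M[k]_m :=
  (\sum_(a : 'X_{1..(nvars d m) < (\sum_(i < d) nu i)%N})
     <<\row_(j < m) (T^`M[a])@_(U_(vx i j))>>)%MS.

(* The first \rank (span_mx T i) rows of this invertible matrix are a basis of  *)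
(* W_i, and all its rows are a basis of V_i.                                    *)
Definition adapted_basis (T : tensor k d m) (i : 'I_d) : 'M[k]_m :=
  row_ebase (span_mx T i).

(* The degree of a monomial in the complementary basis vectors. *)
Definition codegree (T : tensor k d m) (a : 'X_{1..(nvars d m)}) : nat :=
  (\sum_(i < d) \sum_(j < m | \rank (span_mx T i) <= j) a (vx i j))%N.

Definition max_slope (T : tensor k d m) (U : tensor (pseries k) d m) : rat :=
  head 0 (sort <=%R [seq (psval U@_a)%:R / (codegree T a)%:R
                    | a <- msupp U & (0 < codegree T a)%N]).

Definition rescale (T : tensor k d m) (b : rat) (U : tensor (pseries k) d m) :
    tensor (pseries k) d m :=
  \sum_(a <- msupp U)
    ps_shift (absz (numq b) * codegree T a) (ps_ramify (absz (denq b)) U@_a)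
      *: 'X_[a].

Definition unrestriction_step (Tt : tensor (pseries k) d m) :
    tensor (pseries k) d m :=
  let T := limit Tt in
  let to_basis i := map_mx (@ps_const k) (invmx (adapted_basis T i)) in
  let from_basis i := map_mx (@ps_const k) (adapted_basis T i) in
  let U := induced to_basis Tt in
  induced from_basis (rescale T (max_slope T U) U).

Definition unrestriction (n : nat) (Tt : tensor (pseries k) d m) :
    tensor k d m :=
  limit (iter n unrestriction_step Tt).

End Degenerations.

(* Main.v *)
Require Import Defs.
From HB Require Import structures.
From mathcomp Require Import all_boot all_order all_algebra.
From mathcomp.classical Require Import boolp.
From mathcomp.multinomials Require Import mpoly.

Set Implicit Arguments.
Unset Strict Implicit.
Unset Printing Implicit Defensive.

Import Order.TTheory GRing.Theory Num.Theory.
Local Open Scope ring_scope.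

(** Tensors are multihomogeneous polynomials. A functional [f] on the i-th
    vector space acts on them by the derivation [contract i f], and as no
    exponent reaches the characteristic, a tensor lies in the tensor product
    of the symmetric powers of subspaces [W i] exactly when it is killed, for
    every [i], by the contractions with functionals that vanish on [W i]. So a
    tensor is concise exactly when its flattenings, which send [f] to the contraction by
    [f], are injective ([row_free_concise], [concise_row_free]). A flattening
    of a sum of [r] terms has rank at most [r] ([rank_flattening]), and rank
    does not grow in the limit; hence a concise tensor has border rank at least
    [m] ([border_rank_lower]). For (b) it remains to iterate the rescaling step
    until the limit is concise, without raising the rank of the general tensor.

    One step turns [Tt] into [Tt'] with [Tt (t ^ e) = Theta . Tt'], where
    [Theta i] is conjugate over [k] to the diagonal matrix with [r i] entries
    [1] and [m - r i] entries [t ^ c]; here [r i] is the dimension of the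
    subspace [W i] spanned by the limit ([unrestriction_stepP]). This equation
    carries everything that a step preserves ([step_progress]): at [t = 0] it
    exhibits [limit Tt] as a restriction of [limit Tt'], multiplication by the
    adjugates of [Theta] shows that the rank of the general tensor does not
    grow, and restrictions have flattenings of smaller rank, so no [r i] drops.

    The iteration terminates for the following reason. Nondegeneracy of the
    general tensor is witnessed by a nonzero power series, a product of
    determinants built from the flattenings; let [n] be the degree of one of
    its nonzero coefficients ([nondeg_at]). Suppose that a step leaves every
    [r i] unchanged. Then the new limit is obtained from the old one by moving
    the [W i] to graphs of linear maps into the complements, and since the
    contractions by functionals on [W i] are injective on the old limit, a
    nonzero first order motion shows up in codegree one: the maximal slope is
    attained at a monomial of codegree one ([stagnation_codegree_one]). So the
    slope is an integer, [e = 1], and the step divides the witness by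
    [t ^ (c * \sum_i (m - r i))], a positive power of [t]. Either some [r i]
    grows or [n] drops, and a lexicographic induction concludes ([iter_step]).

    For (a), a degeneration of rank [m] need not be concise at [t != 0]. When
    the exponents add up to at least [2], the coefficients and the vectors of
    its decomposition can be moved by multiples of [t] times a denominator, so
    that the coefficients are nonzero and the vectors form bases over [k((t))]
    ([perturb_nondegenerate]). In these bases the tensor is a sum of [m] pure
    powers of distinct variables, whose flattenings are diagonal
    ([nondeg_diag]). When the exponents add up to [1], tensors are vectors, of
    border rank at most [1]; then [m <= 1], and the tensor is concise. *)

(** * Derivatives of induced maps *)

Lemma mpoly_gen_ind (n : nat) (R : nzRingType) (P : {mpoly R[n]} -> Prop) :
    (forall c, P c%:MP) -> (forall i, P 'X_i) ->
    (forall p q, P p -> P q -> P (p + q)) ->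
    (forall p q, P p -> P q -> P (p * q)) -> forall p, P p.
Proof.
move=> PC PX PD PM p; rewrite (mpolyE p).
elim/big_ind: _ => [||a _]; [by rewrite -mpolyC0 | exact: PD |].
rewrite -mul_mpolyC; apply: (PM _ _ (PC _)); rewrite mpolyXE_id.
elim/big_ind: _ => [||i _]; [by rewrite -mpolyC1 | exact: PM |].
by elim: (a i) => [|l IH]; rewrite ?expr0 -?mpolyC1 // exprS; apply: PM.
Qed.

Lemma map_mderiv (n : nat) (R S : nzRingType) (f : {rmorphism R -> S}) (i : 'I_n)
  (p : {mpoly R[n]}) : map_mpoly f p^`M(i) = (map_mpoly f p)^`M(i).
Proof.
apply/mpolyP => a; rewrite mcoeff_map_mpoly !mcoeff_mderiv mcoeff_map_mpoly.
by rewrite raddfMn.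
Qed.

Lemma submm n (a : 'X_{1..n}) : (a - a = 0)%MM.
Proof. by apply/mnmP => i; rewrite mnmBE mnm0E subnn. Qed.

Section Induced.
Variables (R : comNzRingType) (d m : nat).
Implicit Types (T : tensor R d m) (phi psi : 'I_d -> 'M[R]_m).

Lemma vx_eq (i i' : 'I_d) (j j' : 'I_m) :
  (vx i j == vx i' j') = (i == i') && (j == j').
Proof. by rewrite (inj_eq enum_rank_inj). Qed.

Lemma vx_enum_val (a : 'I_(nvars d m)) : vx (enum_val a).1 (enum_val a).2 = a.
Proof. by rewrite /vx -surjective_pairing enum_valK. Qed.

Lemma tensor_ind (P : tensor R d m -> Prop) :
    (forall c, P c%:MP) -> (forall i j, P 'X_(vx i j)) ->
    (forall p q, P p -> P q -> P (p + q)) ->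
    (forall p q, P p -> P q -> P (p * q)) -> forall p, P p.
Proof.
move=> PC PX; apply: mpoly_gen_ind => // a.
by rewrite -(vx_enum_val a); apply: PX.
Qed.

HB.instance Definition _ phi := GRing.Linear.copy (induced phi)
  (comp_mpoly [tuple lin (enum_val a).1 (row (enum_val a).2 (phi (enum_val a).1))
          | a < nvars d m]).
HB.instance Definition _ phi := GRing.RMorphism.copy (induced phi)
  (comp_mpoly [tuple lin (enum_val a).1 (row (enum_val a).2 (phi (enum_val a).1))
          | a < nvars d m]).

Lemma inducedC phi c : induced phi c%:MP = c%:MP.
Proof. by rewrite /induced comp_mpolyC. Qed.

Lemma inducedX phi i j : induced phi 'X_(vx i j) = lin i (row j (phi i)).
Proof.
rewrite /induced comp_mpolyXU -tnth_nth tnth_mktuple /vx enum_rankK //.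
Qed.

Lemma lin_is_linear i : linear (@lin R d m i).
Proof.
move=> c u v; rewrite /lin scaler_sumr -big_split; apply: eq_bigr => j _.
by rewrite !mxE scalerDl scalerA.
Qed.
HB.instance Definition _ i :=
  GRing.isLinear.Build R 'rV[R]_m (tensor R d m) _ (@lin R d m i)
    (lin_is_linear i).

Lemma lin_delta i j : lin i (delta_mx 0 j) = 'X_(vx i j) :> tensor R d m.
Proof.
rewrite /lin (bigD1 j) //= big1 ?addr0 ?mxE ?eqxx ?scale1r // => l lj.
by rewrite !mxE (negPf lj) scale0r.
Qed.

Lemma induced_lin phi i v : induced phi (lin i v) = lin i (v *m phi i).
Proof.
rewrite {1}/lin linear_sum /= mulmx_sum_row linear_sum /=.
by apply: eq_bigr => j _; rewrite linearZ /= inducedX linearZ.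
Qed.

Lemma induced_comp phi psi T :
  induced phi (induced psi T) = induced (fun i => psi i *m phi i) T.
Proof.
elim/tensor_ind: T => [c|i j|p q IHp IHq|p q IHp IHq].
- by rewrite !inducedC.
- by rewrite !inducedX induced_lin row_mul.
- by rewrite !rmorphD /= IHp IHq.
- by rewrite !rmorphM /= IHp IHq.
Qed.

Lemma eq_induced phi psi T : phi =1 psi -> induced phi T = induced psi T.
Proof. by move=> e; congr (induced _ _); apply/funext. Qed.

Lemma induced1 T : induced (fun _ => 1%:M) T = T.
Proof.
elim/tensor_ind: T => [c|i j|p q IHp IHq|p q IHp IHq].
- by rewrite !inducedC.
- by rewrite inducedX row1 lin_delta.
- by rewrite !rmorphD /= IHp IHq.
- by rewrite !rmorphM /= IHp IHq.
Qed.

Lemma mderiv_lin i j i' v :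
  (@lin R d m i' v)^`M(vx i j) = ((i == i')%:R * v 0 j)%:MP.
Proof.
rewrite /lin linear_sum /= (bigD1 j) //= big1 ?addr0; last first.
  move=> l lj; rewrite linearZ /= mderivX mnm1E vx_eq (negPf lj) andbF.
  by rewrite scale0r scaler0.
rewrite linearZ /= mderivX mnm1E vx_eq eqxx andbT eq_sym.
have [<-|ne] := eqVneq i i'; last by rewrite scale0r scaler0 mul0r mpolyC0.
by rewrite scale1r mul1r submm mpolyX0 -mul_mpolyC mulr1.
Qed.

Lemma mderiv_vx (i i' : 'I_d) (j j' : 'I_m) :
  ('X_(vx i' j') : tensor R d m)^`M(vx i j) = ((i == i') && (j == j'))%:R%:MP.
Proof. by rewrite -lin_delta mderiv_lin mxE eqxx -natrM mulnb. Qed.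

(** The chain rule for a linear change of variables. *)
Lemma mderiv_induced phi T i j :
  (induced phi T)^`M(vx i j) =
  \sum_(l < m) phi i l j *: induced phi T^`M(vx i l).
Proof.
elim/tensor_ind: T => [c|i' j'|p q IHp IHq|p q IHp IHq].
- rewrite inducedC mderivC big1 // => l _.
  by rewrite mderivC linear0 scaler0.
- rewrite inducedX mderiv_lin (bigD1 j') //= big1 ?addr0; last first.
    move=> l lj; rewrite mderivX mnm1E vx_eq eq_sym [j' == l]eq_sym (negPf lj) andbF.
    by rewrite scale0r linear0 scaler0.
  rewrite mderiv_vx inducedC !mxE eqxx andbT.
  have [<-|ne] := eqVneq i i'; last by rewrite mul0r mpolyC0 scaler0.
  by rewrite mul1r -mul_mpolyC mulr1.
- rewrite rmorphD !linearD /= IHp IHq -big_split; apply: eq_bigr => l _.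
  by rewrite !linearD.
- rewrite rmorphM /= mderivM IHp IHq mulr_suml mulr_sumr -big_split /=.
  apply: eq_bigr => l _; rewrite mderivM rmorphD !rmorphM /= scalerDr.
  by rewrite scalerAl scalerAr.
Qed.

End Induced.

Section MapInduced.
Variables (R S : comNzRingType) (f : {rmorphism R -> S}) (d m : nat).

Lemma map_lin (i : 'I_d) (v : 'rV[R]_m) :
  map_mpoly f (lin i v) = lin i (map_mx f v).
Proof.
rewrite /lin raddf_sum /=; apply: eq_bigr => j _.
by rewrite map_mpolyZ map_mpolyX mxE.
Qed.

Lemma map_induced (phi : 'I_d -> 'M[R]_m) T :
  map_mpoly f (induced phi T) =
  induced (fun i => map_mx f (phi i)) (map_mpoly f T).
Proof.
elim/tensor_ind: T => [c|i j|p q IHp IHq|p q IHp IHq].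
- by rewrite inducedC !map_mpolyC inducedC.
- by rewrite inducedX map_mpolyX inducedX map_lin map_row.
- by rewrite !rmorphD /= IHp IHq.
- by rewrite !rmorphM /= IHp IHq.
Qed.

End MapInduced.

(** * Multidegrees *)

Section PSTensor.
Variables (R : comNzRingType) (d m : nat).
Implicit Types (T : tensor R d m) (nu : 'I_d -> nat).

Lemma pstensorP nu T :
  reflect (forall a, T@_a != 0 -> forall i, (\sum_(j < m) a (vx i j))%N = nu i)
    (T \in pstensor nu).
Proof.
apply: (iffP allP) => [h a Ta i|h a].
  by move: Ta; rewrite -mcoeff_msupp => /h/forallP/(_ i)/eqP.
by rewrite mcoeff_msupp => /h e; apply/forallP => i; apply/eqP.
Qed.

Lemma eq_pstensor nu nu' T :
  nu =1 nu' -> T \in pstensor nu -> T \in pstensor nu'.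
Proof. by move=> e /pstensorP h; apply/pstensorP => a /h ha i; rewrite ha. Qed.

Lemma pstensor0 nu : 0 \in @pstensor R d m nu.
Proof. by apply/pstensorP => a; rewrite mcoeff0 eqxx. Qed.

Lemma pstensorD nu T T' :
  T \in pstensor nu -> T' \in pstensor nu -> T + T' \in pstensor nu.
Proof.
move=> /pstensorP h /pstensorP h'; apply/pstensorP => a; rewrite mcoeffD.
have [->|/h//] := eqVneq T@_a 0; by rewrite add0r => /h'.
Qed.

Lemma pstensorZ nu c T : T \in pstensor nu -> c *: T \in pstensor nu.
Proof.
move=> /pstensorP h; apply/pstensorP => a; rewrite mcoeffZ => c0; apply: h.
by apply: contraNneq c0 => ->; rewrite mulr0.
Qed.

Lemma pstensor_sum nu (I : Type) (r : seq I) (P : pred I) (F : I -> tensor R d m) :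
  (forall s, P s -> F s \in pstensor nu) ->
  \sum_(s <- r | P s) F s \in pstensor nu.
Proof.
move=> h; elim/big_ind: _ => //; [exact: pstensor0 | exact: pstensorD].
Qed.

Lemma pstensor1 : 1 \in @pstensor R d m (fun _ => 0%N).
Proof.
apply/pstensorP => a; rewrite mcoeff1; have [-> _ i|_] := eqVneq a 0%MM.
  by rewrite big1 // => j _; rewrite mnm0E.
by rewrite eqxx.
Qed.

Lemma pstensorM nu nu' T T' : T \in pstensor nu -> T' \in pstensor nu' ->
  T * T' \in pstensor (fun i => nu i + nu' i)%N.
Proof.
move=> /pstensorP h /pstensorP h'; apply/pstensorP => a.
rewrite -mcoeff_msupp => /msuppM_le /allpairsP[[b c] /= [+ + ->]] i.
rewrite !mcoeff_msupp => /h <- /h' <-; rewrite -big_split /=.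
by apply: eq_bigr => j _; rewrite mnmDE.
Qed.

Lemma pstensor_prod (I : Type) (r : seq I) (nus : I -> 'I_d -> nat)
    (F : I -> tensor R d m) : (forall s, F s \in pstensor (nus s)) ->
  \prod_(s <- r) F s \in pstensor (fun i => \sum_(s <- r) nus s i)%N.
Proof.
move=> h; elim: r => [|s r IH].
  rewrite big_nil; apply: eq_pstensor pstensor1 => i; by rewrite big_nil.
rewrite big_cons; apply: eq_pstensor (pstensorM (h s) IH) => i.
by rewrite big_cons.
Qed.

Lemma pstensorX nu T n : T \in pstensor nu ->
  T ^+ n \in pstensor (fun i => nu i * n)%N.
Proof.
move=> h; rewrite -[n in T ^+ n]card_ord -prodr_const.
apply: eq_pstensor (pstensor_prod _ (fun=> h)) => i.
by rewrite sum_nat_const card_ord mulnC.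
Qed.

Lemma pstensor_lin i v :
  lin i v \in @pstensor R d m (fun i' => i' == i).
Proof.
apply: pstensor_sum => j _; apply: pstensorZ; apply/pstensorP => a.
rewrite mcoeffX; have [<- _ i'|_] := eqVneq (U_(vx i j))%MM a; last by rewrite eqxx.
rewrite (bigD1 j) //= big1 ?addn0 => [|l lj]; rewrite mnm1E vx_eq.
  by rewrite eqxx andbT eq_sym.
by rewrite [j == l]eq_sym (negPf lj) andbF.
Qed.

Lemma pstensor_prod_lin nu (v : forall i : 'I_d, 'I_(nu i) -> 'rV[R]_m) :
  \prod_(i < d) \prod_(a < nu i) lin i (v i a) \in pstensor nu.
Proof.
have h i : \prod_(a < nu i) lin i (v i a) \in
    @pstensor R d m (fun i' => (i' == i) * nu i)%N.
  apply: eq_pstensor (pstensor_prod _ (fun=> pstensor_lin i _)) => i' /=.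
  by rewrite sum_nat_const card_ord mulnC.
apply: eq_pstensor (pstensor_prod _ h) => i /=.
rewrite (bigD1 i) //= eqxx mul1n big1 ?addn0 // => i' ne.
by rewrite eq_sym (negPf ne).
Qed.

Lemma pstensor_prod_linX nu (v : 'I_d -> 'rV[R]_m) :
  \prod_(i < d) lin i (v i) ^+ nu i \in pstensor nu.
Proof.
under eq_bigr => i _ do rewrite -[nu i]card_ord -prodr_const.
exact: pstensor_prod_lin.
Qed.

Lemma mpolyX_prod_vx (a : 'X_{1..(nvars d m)}) :
  'X_[a] = \prod_(i < d) \prod_(j < m) 'X_(vx i j) ^+ a (vx i j) :> tensor R d m.
Proof.
rewrite mpolyXE_id pair_big /=; rewrite (reindex (@enum_rank _)) /=.
  by apply: eq_bigr => -[i j] _.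
by exists enum_val => x _; rewrite ?enum_rankK ?enum_valK.
Qed.

Lemma mdeg_vx (a : 'X_{1..(nvars d m)}) :
  mdeg a = (\sum_(i < d) \sum_(j < m) a (vx i j))%N.
Proof.
rewrite mdegE pair_big /= (reindex (@enum_rank _)) /=.
  by apply: eq_bigr => -[i j] _.
by exists enum_val => x _; rewrite ?enum_rankK ?enum_valK.
Qed.

Lemma pstensor_induced nu phi T :
  T \in pstensor nu -> induced phi T \in pstensor nu.
Proof.
move=> hT; rewrite [T]mpolyE linear_sum /= big_seq; apply: pstensor_sum => a.
rewrite mcoeff_msupp => Ta; rewrite linearZ; apply: pstensorZ.
have {Ta} ha := pstensorP _ _ hT _ Ta.
rewrite mpolyX_prod_vx rmorph_prod /=.
have h i : induced phi (\prod_(j < m) 'X_(vx i j) ^+ a (vx i j)) \in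
    @pstensor R d m (fun i' => (i' == i) * nu i)%N.
  rewrite rmorph_prod /=.
  have h j : induced phi ('X_(vx i j) ^+ a (vx i j)) \in
    @pstensor R d m (fun i' => (i' == i) * a (vx i j))%N.
    rewrite rmorphXn /= inducedX; apply: pstensorX; exact: pstensor_lin.
  apply: eq_pstensor (pstensor_prod _ h) => i' /=.
  by rewrite -big_distrr /= ha.
apply: eq_pstensor (pstensor_prod _ h) => i /=.
rewrite (bigD1 i) //= eqxx mul1n big1 ?addn0 // => i' ne.
by rewrite eq_sym (negPf ne).
Qed.

Lemma pstensor_mdeg nu T a : T \in pstensor nu -> T@_a != 0 ->
  mdeg a = (\sum_(i < d) nu i)%N.
Proof. by move=> /pstensorP h /h ha; rewrite mdeg_vx; apply: eq_bigr. Qed.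

Lemma pstensor_le nu T a i j : T \in pstensor nu -> T@_a != 0 ->
  (a (vx i j) <= nu i)%N.
Proof.
by move=> /pstensorP h /h /(_ i) <-; rewrite (bigD1 j) //= leq_addr.
Qed.

Lemma mderiv_msize nu T i j : T \in pstensor nu ->
  (msize T^`M(vx i j) <= \sum_(i < d) nu i)%N.
Proof.
move=> hT; rewrite msizeE; apply/bigmax_leqP_seq => a + _.
rewrite mcoeff_msupp mcoeff_mderiv => h.
have Ta : T@_(a + U_(vx i j)) != 0 by apply: contraNneq h => ->; rewrite mul0rn.
by rewrite -(pstensor_mdeg hT Ta) mdegD mdeg1 addn1.
Qed.

(** Multihomogeneity: this is how the scalars [\adj (Theta i) *m Theta i] come
    out of a tensor. *)
Lemma induced_scalar nu (c : 'I_d -> R) T : T \in pstensor nu ->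
  induced (fun i => (c i)%:M) T = (\prod_(i < d) c i ^+ nu i) *: T.
Proof.
move=> hT; rewrite {1}[T]mpolyE linear_sum /= [in RHS](mpolyE T) scaler_sumr big_seq [RHS]big_seq.
apply: eq_bigr => a; rewrite mcoeff_msupp => Ta.
rewrite linearZ /= scalerA mulrC -scalerA; congr (_ *: _).
rewrite [in LHS]mpolyX_prod_vx rmorph_prod /= [in RHS]mpolyX_prod_vx.
rewrite -scaler_prod; apply: eq_bigr => i _.
rewrite rmorph_prod /= -(pstensorP _ _ hT _ Ta i) -prodrXr -scaler_prod.
apply: eq_bigr => j _; rewrite rmorphXn /= inducedX -exprZn; congr (_ ^+ _).
by rewrite -scalemx1 linearZ /= row1 linearZ /= lin_delta.
Qed.

End PSTensor.

Lemma pstensor_map (R S : comNzRingType) (f : {rmorphism R -> S}) d m nu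
  (T : tensor R d m) : T \in pstensor nu -> map_mpoly f T \in pstensor nu.
Proof.
move=> /pstensorP h; apply/pstensorP => a; rewrite mcoeff_map_mpoly => fT.
by apply: h; apply: contraNneq fT => ->; rewrite raddf0.
Qed.

(** * Contractions and flattenings *)

(** The form in which the hypothesis on the characteristic is used; unlike that
    hypothesis it makes sense over [k], [k[[t]]] and [k((t))] alike. *)
Definition regular_exponents (R : nzRingType) d (nu : 'I_d -> nat) :=
  forall i n, (0 < n <= nu i)%N -> n%:R != 0 :> R.

Section Flattening.
Variables (R : comNzRingType) (d m : nat) (nu : 'I_d -> nat).
Implicit Types (T : tensor R d m).

(** The derivation extending the functional [f] of the i-th space. *)
Definition contract (i : 'I_d) (f : 'rV[R]_m) T : tensor R d m :=
  \sum_(j < m) f 0 j *: T^`M(vx i j).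

Local Notation N := (\sum_(i < d) nu i)%N.
Local Notation K := #|{: 'X_{1..(nvars d m) < N}}|.
Local Notation mono b := (enum_val b : 'X_{1..(nvars d m) < N}).

(** The contraction of [T] as a linear map from functionals to polynomials. All
    degrees below that of [T] are kept as column indices, which match those in
    [span_mx]. *)
Definition flattening T (i : 'I_d) : 'M[R]_(m, K) :=
  \matrix_(j, b) (T^`M(vx i j))@_(mono b).

Lemma mul_flattening T i f b :
  (f *m flattening T i) 0 b = (contract i f T)@_(mono b).
Proof.
rewrite /contract linear_sum mxE; apply: eq_bigr => j _.
by rewrite linearZ mxE.
Qed.

Lemma contract_msize T i f : T \in pstensor nu -> (msize (contract i f T) <= N)%N.
Proof.
move=> hT; apply: leq_trans (msize_sum _ _ _) _; apply/bigmax_leqP_seq => j _ _.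
by apply: leq_trans (mmeasureZ_le _ _ _) _; apply: mderiv_msize.
Qed.

Lemma contract_eq0 T i f : T \in pstensor nu ->
  (f *m flattening T i = 0) <-> (contract i f T = 0).
Proof.
move=> hT; split=> [h|h]; last first.
  by apply/rowP => b; rewrite mul_flattening h mcoeff0 mxE.
rewrite (mpolywE (contract_msize i f hT)) big1 // => b _.
have := mul_flattening T i f (enum_rank b); rewrite h enum_rankK mxE => <-.
by rewrite scale0r.
Qed.

(** The substitution acting on the column space of flattenings. *)
Definition induced_mx (phi : 'I_d -> 'M[R]_m) : 'M[R]_K :=
  \matrix_(b, c) (induced phi 'X_[mono b])@_(mono c).

Lemma flattening_induced phi T i : T \in pstensor nu ->
  flattening (induced phi T) i =
  (phi i)^T *m flattening T i *m induced_mx phi.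
Proof.
move=> hT; apply/matrixP => j c; rewrite mxE mderiv_induced linear_sum /= -mulmxA mxE.
apply: eq_bigr => l _; rewrite linearZ /= !mxE; congr (_ * _).
rewrite {1}(mpolywE (mderiv_msize i l hT)) (linear_sum (induced phi)) linear_sum /=.
rewrite (reindex (fun b : 'I_K => mono b)) /=.
  by apply: eq_bigr => b _; rewrite !linearZ /= !mxE.
by exists enum_rank => b _; rewrite ?enum_rankK ?enum_valK.
Qed.

Lemma flatteningZ c T i : flattening (c *: T) i = c *: flattening T i.
Proof. by apply/matrixP => j b; rewrite !mxE !linearZ. Qed.

Lemma contract_induced phi T i f :
  contract i f (induced phi T) = induced phi (contract i (f *m (phi i)^T) T).
Proof.
rewrite /contract linear_sum /=.
under eq_bigr do rewrite mderiv_induced scaler_sumr.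
rewrite exchange_big /=; apply: eq_bigr => l _.
rewrite linearZ /=.
under eq_bigr do rewrite scalerA.
rewrite -scaler_suml; congr (_ *: _); rewrite mxE.
by apply: eq_bigr => j _; rewrite mxE.
Qed.

End Flattening.

Lemma flattening_map (R S : comNzRingType) (f : {rmorphism R -> S}) d m nu
    (T : tensor R d m) i :
  flattening nu (map_mpoly f T) i = map_mx f (flattening nu T i).
Proof.
by apply/matrixP => j b; rewrite !mxE -map_mderiv mcoeff_map_mpoly.
Qed.

Section FieldFlattening.
Variables (F : fieldType) (d m : nat) (nu : 'I_d -> nat).
Hypothesis regF : regular_exponents F nu.
Implicit Types (T : tensor F d m).
Local Notation N := (\sum_(i < d) nu i)%N.

(** A derivative vanishes only if the variable is absent: the exponents that
    occur are at most [nu i], hence nonzero in [F]. *)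
Lemma mcoeff_mderiv_eq0 T i j (a : 'X_{1..(nvars d m)}) : T \in pstensor nu -> T^`M(vx i j) = 0 ->
  (0 < a (vx i j))%N -> T@_a = 0.
Proof.
move=> hT dT a0; apply/eqP/contraT => Ta.
have ea : (a = (a - U_(vx i j)) + U_(vx i j))%MM.
  by rewrite submK // lep1mP -lt0n.
have := mcoeff_mderiv (vx i j) T (a - U_(vx i j))%MM; rewrite dT mcoeff0 -ea.
rewrite mnmBE mnm1E eqxx subn1 prednK // -mulr_natr => /esym/eqP.
rewrite mulf_eq0 (negPf Ta) /= (negPf (regF (i := i) _)) //.
by rewrite a0 (pstensor_le _ _ hT Ta).
Qed.

Lemma regular_factorial i n : (n <= nu i)%N -> n`!%:R != 0 :> F.
Proof.
elim: n => [|n IH] le; first by rewrite oner_eq0.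
by rewrite factS natrM mulf_neq0 ?IH ?(ltnW le) // (regF (i := i)).
Qed.

Lemma contract_factorial_neq0 T i f (a : 'X_{1..(nvars d m)}) :
  T \in pstensor nu -> (contract i f T)@_a != 0 -> (\prod_v (a v)`!)%:R != 0 :> F.
Proof.
move=> hT h; have [j Ta] : exists j, T@_(a + U_(vx i j)) != 0.
  apply/existsP; apply: contraNT h => /existsPn h.
  rewrite /contract linear_sum big1 // => j _; rewrite linearZ /= mcoeff_mderiv.
  by have := h j; rewrite negbK => /eqP ->; rewrite mul0rn mulr0.
rewrite natr_prod; apply/prodf_neq0 => v _; apply: (@regular_factorial (enum_val v).1).
apply: leq_trans (pstensor_le (enum_val v).1 (enum_val v).2 hT Ta).
by rewrite vx_enum_val mnmDE leq_addr.
Qed.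

(** The higher derivatives in [span_mx] are the rows of the flattening
    multiplied by factorials, which are units here. *)
Lemma span_mx_contract T i f : T \in pstensor nu ->
  (span_mx nu T i *m f^T == 0) = (contract i f T == 0).
Proof.
move=> hT.
have rowE (a : 'X_{1..(nvars d m)}) :
    (\row_(j < m) (T^`M[a])@_(U_(vx i j))) *m f^T =
    ((\prod_v (a v)`!)%:R * (contract i f T)@_a)%:M.
  apply/rowP => z; rewrite ord1 !mxE eqxx mulr1n /contract linear_sum mulr_sumr.
  apply: eq_bigr => j _; rewrite !mxE linearZ /= mcoeff_mderivm mcoeff_mderiv.
  rewrite mulrC [RHS]mulrCA; congr (_ * _).
  rewrite mulr_natl -mulrnA; congr (_ *+ _).
  rewrite (bigD1 (vx i j)) //= [in RHS](bigD1 (vx i j)) //=.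
  rewrite mnmDE mnm1E eqxx addn1 mulnA; congr (_ * _)%N.
    by rewrite -[(a _)`!]ffactnn -ffactSS ffactnSr subSnn muln1.
  by apply: eq_bigr => v ne; rewrite mnmDE mnm1E eq_sym (negPf ne) addn0 ffactnn.
rewrite -sub_kermx; apply/sumsmx_subP/eqP => [h | h b _]; last first.
  rewrite genmxE sub_kermx rowE h mcoeff0 mulr0; apply/eqP/rowP => z.
  by rewrite !mxE mul0rn.
rewrite (mpolywE (contract_msize i f hT)) big1 // => b _.
have := h b isT; rewrite genmxE sub_kermx rowE => /eqP/rowP/(_ 0).
rewrite !mxE eqxx mulr1n => /eqP; rewrite mulf_eq0.
have [->|/(contract_factorial_neq0 hT)/negPf ->//] := eqVneq (contract i f T)@_b 0.
by rewrite scale0r.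
Qed.

Lemma rank_span_mx T i : T \in pstensor nu ->
  \rank (span_mx nu T i) = \rank (flattening nu T i).
Proof.
move=> hT.
have e : (kermx (flattening nu T i) == kermx (span_mx nu T i)^T)%MS.
  apply/andP; split; apply/row_subP => j; rewrite sub_kermx.
    rewrite -[_ *m _]trmxK trmx_mul trmxK -trmx0 (inj_eq trmx_inj).
    rewrite span_mx_contract //; apply/eqP/(contract_eq0 _ _ hT).
    by apply/eqP; rewrite -sub_kermx row_sub.
  apply/eqP/(contract_eq0 _ _ hT)/eqP; rewrite -span_mx_contract //.
  rewrite -[_ *m _]trmxK trmx_mul trmxK -trmx0 (inj_eq trmx_inj).
  by rewrite -sub_kermx row_sub.
have := eqmx_rank e; rewrite !mxrank_ker mxrank_tr => /eqP.
by rewrite eq_sym eqn_sub2lE ?rank_leq_row // => /eqP.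
Qed.

(** In an adapted basis the tensor involves only the basis vectors of [W i]: the
    last columns of the inverse matrix are functionals that vanish on [W i]. *)
Lemma adapted_mderiv_eq0 T i (j : 'I_m) : T \in pstensor nu ->
  (\rank (span_mx nu T i) <= j)%N ->
  (induced (fun i => invmx (adapted_basis nu T i)) T)^`M(vx i j) = 0.
Proof.
move=> hT rj; set phi := fun i => invmx _.
have -> : (induced phi T)^`M(vx i j) =
    induced phi (contract i (col j (phi i))^T T).
  rewrite mderiv_induced linear_sum /=; apply: eq_bigr => l _.
  by rewrite linearZ /= !mxE.
have /eqP -> : contract i (col j (phi i))^T T == 0; last by rewrite linear0.
rewrite -span_mx_contract // trmxK -{1}(mulmx_ebase (span_mx nu T i)).
rewrite colE mulmxA /phi mulmxK ?row_ebase_unit //.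
rewrite -colE; apply/eqP/colP => l; rewrite !mxE big1 // => s _; rewrite mxE.
case: andP => [[/eqP e lt]|]; last by rewrite mulr0.
by rewrite e ltnNge rj in lt.
Qed.

End FieldFlattening.

(** * Conciseness and rank in terms of flattenings *)

Section Derivation.
Variables (R : comNzRingType) (d m : nat).
Implicit Types (p q : tensor R d m) (f v : 'rV[R]_m).

Lemma contract_is_linear i f : linear (@contract R d m i f).
Proof.
move=> c p q; rewrite /contract scaler_sumr -big_split; apply: eq_bigr => j _ /=.
by rewrite linearP /= scalerDr !scalerA mulrC.
Qed.
HB.instance Definition _ i f := GRing.isLinear.Build R (tensor R d m)
  (tensor R d m) _ (@contract R d m i f) (contract_is_linear i f).

Lemma contractM i f p q :
  contract i f (p * q) = contract i f p * q + p * contract i f q.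
Proof.
rewrite /contract mulr_suml mulr_sumr -big_split; apply: eq_bigr => j _ /=.
by rewrite mderivM scalerDr scalerAl scalerAr.
Qed.

Lemma contract1 i f : contract i f 1 = 0 :> tensor R d m.
Proof. by rewrite /contract big1 // => j _; rewrite mderivC scaler0. Qed.

Lemma contract_lin i f i' v :
  contract i f (lin i' v) = ((i == i')%:R * (v *m f^T) 0 0)%:MP :> tensor R d m.
Proof.
rewrite /contract mxE mulr_sumr raddf_sum /=; apply: eq_bigr => j _.
rewrite mderiv_lin mxE -mul_mpolyC -mpolyCM; congr (_%:MP).
by rewrite mulrCA [f _ _ * _]mulrC.
Qed.

Lemma contractX i f p n :
  contract i f (p ^+ n) = n%:R *: (p ^+ n.-1 * contract i f p).
Proof.
elim: n => [|n IH]; first by rewrite contract1 scale0r.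
rewrite exprS contractM IH /= mulrC -scalerAr mulrA.
have -> : n%:R *: (p * p ^+ n.-1 * contract i f p) =
    n%:R *: (p ^+ n * contract i f p).
  by case: n {IH} => [|n]; rewrite ?scale0r // -exprS.
by rewrite -[X in X + _]scale1r -scalerDl nat1r.
Qed.

Lemma contract_prod_eq0 i f (I : Type) (r : seq I) (P : pred I)
  (F : I -> tensor R d m) : (forall s, P s -> contract i f (F s) = 0) ->
  contract i f (\prod_(s <- r | P s) F s) = 0.
Proof.
move=> h; elim/big_ind: _ => //; first exact: contract1.
by move=> p q p0 q0; rewrite contractM p0 q0 mul0r mulr0 addr0.
Qed.

Lemma contract_prod_linX (nu : 'I_d -> nat) i f (l : 'I_d -> 'rV[R]_m) :
  contract i f (\prod_(i' < d) lin i' (l i') ^+ nu i') =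
  ((nu i)%:R * (l i *m f^T) 0 0) *:
    (lin i (l i) ^+ (nu i).-1 * \prod_(i' < d | i' != i) lin i' (l i') ^+ nu i')
  :> tensor R d m.
Proof.
rewrite (bigD1 i) //= contractM [X in _ + _ * X]contract_prod_eq0; last first.
  move=> i' ne; rewrite contractX contract_lin eq_sym (negPf ne) mul0r.
  by rewrite mpolyC0 mulr0 scaler0.
rewrite mulr0 addr0 contractX contract_lin eqxx mul1r.
rewrite [_ * _%:MP]mulrC mul_mpolyC scalerA -scalerAl; congr (_ *: _).
Qed.

Lemma lin_eq0 i v : (@lin R d m i v == 0) = (v == 0).
Proof.
apply/eqP/eqP => [h|->]; last by rewrite linear0.
apply/rowP => j; rewrite mxE; have := congr1 (mcoeff U_(vx i j)%MM) h.
rewrite mcoeff0 /lin linear_sum (bigD1 j) //= big1 ?addr0 => [|l lj].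
  by rewrite mcoeffZ mcoeffX eqxx mulr1.
by rewrite mcoeffZ mcoeffX eq_mnm1 vx_eq (negPf lj) andbF mulr0.
Qed.

End Derivation.

Lemma contract_delta (R : comNzRingType) d m (T : tensor R d m) i (j : 'I_m) :
  contract i (delta_mx 0 j) T = T^`M(vx i j).
Proof.
rewrite /contract (bigD1 j) //= big1 ?addr0 ?mxE ?eqxx ?scale1r // => j' ne.
by rewrite !mxE (negPf ne) scale0r.
Qed.

Lemma contractBl (R : comNzRingType) d m (T : tensor R d m) i f g :
  contract i (f - g) T = contract i f T - contract i g T.
Proof.
rewrite /contract -sumrB; apply: eq_bigr => j _.
by rewrite !mxE scalerBl.
Qed.

Section Conciseness.
Variables (F : fieldType) (d m : nat) (nu : 'I_d -> nat).
Implicit Types (T U : tensor F d m) (W : 'I_d -> {vspace 'rV[F]_m}).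

(** Each monomial of [U] is sent to a product of vectors [row j (psi i)], listed
    with multiplicity in [fac]. *)
Lemma in_subtensor_induced (psi : 'I_d -> 'M[F]_m) U W : U \in pstensor nu ->
    (forall (a : 'X_{1..(nvars d m)}) i j, U@_a != 0 -> (0 < a (vx i j))%N ->
       row j (psi i) \in W i) ->
  in_subtensor nu W (induced psi U).
Proof.
move=> hU hW.
pose mon s := nth 0%MM (msupp U) s.
pose fac s i := flatten [seq nseq (mon s (vx i j)) (row j (psi i)) | j <- index_enum (ordinal m)].
have Us (s : 'I_(size (msupp U))) : U@_(mon s) != 0.
  by rewrite -mcoeff_msupp mem_nth.
have size_fac (s : 'I_(size (msupp U))) i : size (fac s i) = nu i.
  rewrite size_flatten sumnE !big_map -(pstensorP _ _ hU _ (Us s) i). 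
  by apply: eq_bigr => j _; rewrite size_nseq.
exists (size (msupp U)), (fun s => U@_(mon s)), (fun s i x => nth 0 (fac s i) x).
split.
  move=> s i x.
  have : nth 0 (fac s i) x \in fac s i by rewrite mem_nth // size_fac.
  case/flatten_mapP => j _; rewrite mem_nseq => /andP[lt /eqP ->].
  exact: hW lt.
rewrite {1}[U]mpolyE linear_sum (big_nth 0%MM) big_mkord; apply: eq_bigr => s _.
rewrite -/(mon s) linearZ; congr (_ *: _).
rewrite mpolyX_prod_vx rmorph_prod; apply: eq_bigr => i _.
rewrite rmorph_prod /= -(big_mkord xpredT (fun x => lin i (nth 0 (fac s i) x))).
rewrite -{1}(size_fac s i) -(big_nth 0 xpredT (fun v => lin i v)) big_flatten big_map.
apply: eq_bigr => j _.
by rewrite rmorphXn /= inducedX big_nseq -Monoid.iteropE.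
Qed.

Lemma in_subtensor_contract W T i f :
  in_subtensor nu W T -> (forall v, v \in W i -> v *m f^T = 0) ->
  contract i f T = 0.
Proof.
move=> [r [c [w [hw ->]]]] hf; rewrite linear_sum big1 // => s _.
rewrite linearZ /= contract_prod_eq0 ?scaler0 // => i' _.
apply: contract_prod_eq0 => x _; rewrite contract_lin.
have [e|_] := eqVneq i i'; last by rewrite mul0r mpolyC0.
by rewrite -[w s i' x]/(w s i' x) hf ?mxE ?mulr0 ?mpolyC0 // e.
Qed.

Lemma vspace_annihilator (W : {vspace 'rV[F]_m}) : W != fullv ->
  exists2 f : 'rV[F]_m, f != 0 & forall v, v \in W -> v *m f^T = 0.
Proof.
move=> Wn.
have dW : (\dim W < m)%N.
  have e : \dim {:'rV[F]_m} = m by rewrite dimvf /dim /= mul1n.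
  rewrite -[m in (_ < m)%N]e ltn_neqAle dimvS ?subvf // andbT.
  by apply: contra Wn => /eqP eW; rewrite eqEdim subvf eW leqnn.
pose M := \matrix_(s < \dim W) (vbasis W)`_s.
have : kermx M^T != 0.
  rewrite -mxrank_eq0 mxrank_ker mxrank_tr -lt0n subn_gt0.
  exact: leq_ltn_trans (rank_leq_row _) dW.
case/rowV0Pn => f /sub_kermxP fM f0; exists f => // v.
rewrite -(span_basis (vbasisP W)) => vW.
have sub : (<<vbasis W>> <= lker (linfun (mulmxr f^T)))%VS.
  apply/span_subvP => x /(nthP 0)[s]; rewrite size_tuple => ls <-.
  rewrite memv_ker lfunE /=; apply/eqP.
  have /rowP/(_ (Ordinal ls)) := fM; rewrite !mxE => e.
  apply/rowP => z; rewrite ord1 !mxE -[RHS]e; apply: eq_bigr => j _.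
  by rewrite !mxE mulrC.
by have := subvP sub v vW; rewrite memv_ker lfunE => /eqP.
Qed.

(** A functional that vanishes on a proper [W i] contracts the whole subtensor
    space to zero. *)
Lemma row_free_concise T : T \in pstensor nu ->
  (forall i, row_free (flattening nu T i)) -> concise nu T.
Proof.
move=> hT free W [S hS nS] TW; apply: nS; rewrite -[S]induced1.
apply: in_subtensor_induced => // a i j _ _.
suff /eqP -> : W i == fullv by rewrite memvf.
apply/negPn/negP => /vspace_annihilator[f f0 fW].
have /(contract_eq0 _ _ hT) := in_subtensor_contract TW fW.
move/eqP; rewrite mulmx_free_eq0 ?free // => /eqP e.
by rewrite e eqxx in f0.
Qed.

(** The flattening of a sum of [r] pure tensors factors through the space of
    dimension [r] with one basis vector for each summand. *)
Lemma rank_flattening T r i : rank_le nu r T -> (\rank (flattening nu T i) <= r)%N.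
Proof.
move=> [c [l ->]]; set N := (\sum_(i < d) nu i)%N.
pose G s : tensor F d m := lin i (l s i) ^+ (nu i).-1 *
  \prod_(i' < d | i' != i) lin i' (l s i') ^+ nu i'.
pose X : 'M[F]_(r, #|{: 'X_{1..(nvars d m) < N}}|) :=
  \matrix_(s, b) (c s * (nu i)%:R * (G s)@_((enum_val b : 'X_{1..(nvars d m) < N}))).
suff -> : flattening nu (\sum_(s < r) c s *: \prod_(i < d) lin i (l s i) ^+ nu i) i
   = (\matrix_(s < r) l s i)^T *m X by exact: mulmx_max_rank.
apply/matrixP => j b; rewrite !mxE.
rewrite -contract_delta (linear_sum (contract i _)) raddf_sum /=; apply: eq_bigr => s _.
rewrite linearZ /= contract_prod_linX !linearZ /= !mxE -/(G s).
rewrite !mulrA; congr (_ * _); rewrite (bigD1 j) //= big1 ?addr0 => [|j' ne].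
  by rewrite !mxE !eqxx mulr1 mulrC mulrA.
by rewrite !mxE (negPf ne) mulr0.
Qed.

Hypothesis regF : regular_exponents F nu.
Hypothesis nu_gt0 : forall i, (0 < nu i)%N.

(** A tensor always lies in the subtensor space of the subspaces spanned by its
    own derivatives. If one of them is proper, a functional vanishing on it
    separates this subtensor space from a pure power. *)
Lemma concise_row_free T i : T \in pstensor nu -> concise nu T ->
  row_free (flattening nu T i).
Proof.
move=> hT cT; rewrite /row_free -rank_span_mx // eqn_leq rank_leq_row /= leqNgt.
apply/negP => rm.
pose A := adapted_basis nu T.
pose W i := <<[seq row j (A i) | j : 'I_m in [pred j : 'I_m | j < \rank (span_mx nu T i)]%N]>>%VS.
have Aunit i' : A i' \in unitmx by exact: row_ebase_unit.
pose U := induced (fun i => invmx (A i)) T.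
have hU : U \in pstensor nu by exact: pstensor_induced.
have TU : T = induced A U.
  rewrite /U induced_comp -[LHS]induced1; apply: eq_induced => i'.
  by rewrite mulVmx.
apply: (cT W).
  pose j0 := Ordinal rm; pose f := (col j0 (invmx (A i)))^T.
  pose v := row j0 (A i).
  have fA j : (row j (A i) *m f^T) 0 0 = (j == j0)%:R.
    by rewrite trmxK -row_mul colE mulmxA mulmxV // mul1mx !mxE andbT.
  exists (\prod_(i < d) lin i v ^+ nu i); first exact: pstensor_prod_linX.
  move/in_subtensor_contract => /(_ i f) h.
  have {h} : contract i f (\prod_(i < d) lin i v ^+ nu i) = 0.
    apply: h => x xW; have sub : (W i <= lker (linfun (mulmxr f^T)))%VS.
      apply/span_subvP => y /imageP[j]; rewrite inE => lt ->.
      rewrite memv_ker lfunE /=; apply/eqP/rowP => z; rewrite ord1 fA mxE.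
      by rewrite -val_eqE /= ltn_eqF.
    by have := subvP sub x xW; rewrite memv_ker lfunE => /eqP.
  move/eqP; rewrite contract_prod_linX fA eqxx mulr1 -mul_mpolyC.
  have v0 : v != 0.
    apply/eqP => v0; have := fA j0; rewrite -/v v0 mul0mx mxE eqxx.
    by move/esym/eqP; rewrite oner_eq0.
  apply/negP; rewrite !mulf_neq0 ?expf_neq0 ?lin_eq0 //.
    by rewrite mpolyC_eq0 (regF (i := i)) // nu_gt0 leqnn.
  by apply/prodf_neq0 => i' _; rewrite expf_neq0 // lin_eq0.
rewrite [T]TU; apply: in_subtensor_induced => // a i' j Ua aj.
apply/memv_span/imageP; exists j => //; rewrite inE ltnNge; apply/negP => rj.
move: Ua; rewrite (mcoeff_mderiv_eq0 regF hU _ aj) ?eqxx //.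
exact: adapted_mderiv_eq0.
Qed.

End Conciseness.

(** * Power series and their fractions *)

Section PowerSeries.
Variable R : comNzRingType.
Implicit Types f g : pseries R.

Lemma pscoef0 n : (0 : pseries R) n = 0.
Proof. by case: n. Qed.

Lemma pscoefM f g n : (f * g) n = \sum_(i < n.+1) f i * g (n - i)%N.
Proof. by []. Qed.

Lemma pscoef0M f g : (f * g) 0%N = f 0%N * g 0%N.
Proof. by rewrite pscoefM big_ord_recl big_ord0 addr0. Qed.

Lemma pscoef_neq0 f : f != 0 -> exists n, f n != 0.
Proof.
move=> f0; apply: contrapT => h; case/eqP: f0; apply/pseriesP => n.
by rewrite pscoef0; apply/eqP/negPn/negP => fn; apply: h; exists n.
Qed.

Lemma psvalP f : f != 0 ->
  f (psval f) != 0 /\ forall n, (n < psval f)%N -> f n = 0.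
Proof.
move=> /pscoef_neq0 e; rewrite /psval; case: pselect => // e'.
case: ex_minnP => v fv min_v; split=> // n nv; apply/eqP/contraT => /min_v.
by rewrite leqNgt nv.
Qed.

Definition ps_eval0 f : R := f 0%N.

Fact ps_eval0_is_zmod_morphism : zmod_morphism ps_eval0.
Proof. by []. Qed.
Fact ps_eval0_is_monoid_morphism : monoid_morphism ps_eval0.
Proof. by split=> // f g; apply: pscoef0M. Qed.
HB.instance Definition _ := GRing.isZmodMorphism.Build (pseries R) R ps_eval0
  ps_eval0_is_zmod_morphism.
HB.instance Definition _ := GRing.isMonoidMorphism.Build (pseries R) R ps_eval0
  ps_eval0_is_monoid_morphism.

Fact ps_const_is_zmod_morphism : zmod_morphism (@ps_const R).
Proof. by move=> a b; apply/pseriesP => -[|n] //=; rewrite subrr. Qed.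
Fact ps_const_is_monoid_morphism : monoid_morphism (@ps_const R).
Proof.
split=> // a b; apply/pseriesP => -[|n]; first by rewrite pscoef0M.
rewrite pscoefM big1 // => -[[|i] lti] _ /=; last by rewrite mul0r.
by rewrite mulr0.
Qed.
HB.instance Definition _ := GRing.isZmodMorphism.Build R (pseries R)
  (@ps_const R) ps_const_is_zmod_morphism.
HB.instance Definition _ := GRing.isMonoidMorphism.Build R (pseries R)
  (@ps_const R) ps_const_is_monoid_morphism.

Variable e : nat.

Fact ps_ramify_is_zmod_morphism : zmod_morphism (@ps_ramify R e).
Proof. by move=> f g; apply/pseriesP => n /=; case: ifP => // _; rewrite subrr. Qed.
Fact ps_ramify_is_monoid_morphism : monoid_morphism (@ps_ramify R e).
Proof.
split=> [|f g]; apply/pseriesP => n.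
  rewrite /=; case: n => [|n]; first by rewrite dvdn0 div0n.
  case: ifP => // /dvdnP[[|q] nq]; first by rewrite mul0n in nq.
  by case: e nq => [|e']; rewrite ?muln0 // => ->; rewrite mulnK.
rewrite [RHS]pscoefM /=.
have sum_dvd (G : nat -> nat -> R) :
    \sum_(i < n.+1) (if (e %| i)%N then G (i %/ e)%N (n - i)%N else 0) =
    \sum_(i < n.+1 | (e %| i)%N) G (i %/ e)%N (n - i)%N.
  by rewrite [RHS]big_mkcond.
rewrite [RHS](eq_bigr (fun i : 'I_n.+1 => if (e %| i)%N then
   f (i %/ e)%N * (if (e %| n - i)%N then g ((n - i) %/ e)%N else 0) else 0));
   last by move=> i _; case: ifP => //; rewrite mul0r.
rewrite (sum_dvd (fun j l => f j * (if (e %| l)%N then g (l %/ e)%N else 0))).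
case: ifP => [/dvdnP[q nq]|ndvd]; last first.
  rewrite big1 // => i ei; case: ifP; last by rewrite mulr0.
  by rewrite dvdn_subl ?ndvd // -ltnS.
case: (posnP e) nq => [-> nq|e_gt0 nq].
  move: nq; rewrite muln0 => ->; rewrite div0n [RHS]big_mkcond /=.
  by rewrite !big_ord_recl !big_ord0.
rewrite nq mulnK //.
have lt_e (j : 'I_q.+1) : (j * e < (q * e).+1)%N.
  by rewrite ltnS leq_mul2r -ltnS ltn_ord orbT.
rewrite (reindex_onto (fun j : 'I_q.+1 => Ordinal (lt_e j))
  (fun i => inord (i %/ e))) /=.
  apply: eq_big => [j|j _].
    by rewrite dvdn_mull // mulnK // inord_val eqxx.
  by rewrite -mulnBl dvdn_mull // !mulnK.
move=> i /dvdnP[j ij]; apply/val_inj; rewrite /= ij mulnK // inordK //.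
by rewrite -(ltn_pmul2r e_gt0) -ij mulSn; apply: leq_trans (ltn_ord i) _; rewrite -addn1 addnC leq_add2r.
Qed.
HB.instance Definition _ := GRing.isZmodMorphism.Build (pseries R) (pseries R)
  (@ps_ramify R e) ps_ramify_is_zmod_morphism.
HB.instance Definition _ := GRing.isMonoidMorphism.Build (pseries R) (pseries R)
  (@ps_ramify R e) ps_ramify_is_monoid_morphism.

Lemma ps_ramify_eval0 f : ps_eval0 (ps_ramify e f) = ps_eval0 f.
Proof. by rewrite /ps_eval0 /= dvdn0 div0n. Qed.

Lemma ps_ramify_const (c : R) : ps_ramify e (ps_const c) = ps_const c.
Proof.
apply/pseriesP => -[|n] /=; first by rewrite dvdn0 div0n.
case: ifP => // /dvdnP[[|q] nq]; first by rewrite mul0n in nq.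
by case: e nq => [|e']; rewrite ?muln0 // => ->; rewrite mulnK.
Qed.

Lemma ps_ramify_mul f n : (0 < e)%N -> ps_ramify e f (n * e)%N = f n.
Proof. by move=> e0; rewrite /= dvdn_mull // mulnK. Qed.

Lemma ps_ramify_inj : (0 < e)%N -> injective (@ps_ramify R e).
Proof.
move=> e0 f g fg; apply/pseriesP => n.
by rewrite -(ps_ramify_mul f n e0) fg ps_ramify_mul.
Qed.

End PowerSeries.

Lemma ps_ramify1 (R : comNzRingType) (f : pseries R) : ps_ramify 1 f = f.
Proof. by apply/pseriesP => n /=; rewrite dvd1n divn1. Qed.

Section Uniformizer.
Variable R : comNzRingType.
Implicit Types f g : pseries R.

(** The variable [t]. *)
Definition psX : pseries R := PSeries (fun n => (n == 1)%:R).

Lemma pscoef_XM f n : (psX * f) n = if n is n'.+1 then f n' else 0.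
Proof.
rewrite pscoefM; case: n => [|n].
  by rewrite big_ord_recl big_ord0 /= mul0r addr0.
rewrite 2!big_ord_recl big1 /= ?mul0r ?add0r ?addr0 ?mul1r ?subSS ?subn0 //.
by move=> i _; rewrite mul0r.
Qed.

Lemma pscoef_XnM c f n : (psX ^+ c * f) n = if (n < c)%N then 0 else f (n - c)%N.
Proof.
elim: c n => [|c IH] n; first by rewrite expr0 mul1r subn0.
rewrite exprS -mulrA pscoef_XM; case: n => [|n] //.
Qed.

Lemma ps_shiftK c f : (forall n, (n < c)%N -> f n = 0) ->
  psX ^+ c * ps_shift c f = f.
Proof.
move=> h; apply/pseriesP => n; rewrite pscoef_XnM; case: ltnP => [/h//|cn] /=.
by rewrite subnK.
Qed.

Lemma psXn_neq0 c : psX ^+ c != 0.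
Proof.
apply/eqP => /(congr1 (fun f : pseries R => f c)).
rewrite -[psX ^+ c]mulr1 pscoef_XnM ltnn subnn pscoef0 => /eqP.
by rewrite oner_eq0.
Qed.

Lemma psXn_inj : injective (fun c => psX ^+ c).
Proof.
move=> c c' /(congr1 (fun f : pseries R => f c)).
rewrite -[psX ^+ c]mulr1 -[psX ^+ c']mulr1 !pscoef_XnM ltnn subnn.
case: ltnP => [_ /eqP|]; first by rewrite oner_eq0.
case: ltngtP => // lt _; rewrite -(subnSK lt) /= => /eqP.
by rewrite oner_eq0.
Qed.

End Uniformizer.

Lemma natr_pseries (R : comNzRingType) n : n%:R = ps_const n%:R :> pseries R.
Proof. by rewrite rmorph_nat. Qed.

Section Denominators.
Variable R : idomainType.
Local Notation frac := (@tofrac R).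

Lemma frac_denominator (x : {fraction R}) :
  exists2 d : R, d != 0 & exists n, frac d * x = frac n.
Proof.
elim/quotW: x => y; exists \d_y; first exact: denom_ratioP.
exists \n_y; apply/eqP; rewrite !piE /FracField.equivf /FracField.mulf.
by rewrite !numden_Ratio ?mul1r ?mulr1 ?denom_ratioP ?oner_neq0 // mulrC.
Qed.

Lemma common_denominator (I : finType) (x : I -> {fraction R}) :
  exists2 d : R, d != 0 & exists n : I -> R, forall i, frac d * x i = frac (n i).
Proof.
have h i := cid2 (frac_denominator (x i)).
pose d i := s2val (h i).
have d0 i : d i != 0 by exact: s2valP (h i).
have hn i : exists n, frac (d i) * x i = frac n by exact: s2valP' (h i).
pose n i := projT1 (cid (hn i)).
have nE i : frac (d i) * x i = frac (n i) by exact: projT2 (cid (hn i)).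
exists (\prod_i d i); first by apply/prodf_neq0.
exists (fun i => (\prod_(i' | i' != i) d i') * n i) => i.
by rewrite (bigD1 i) //= !rmorphM /= -nE mulrA [X in X * _]mulrC.
Qed.

End Denominators.

(** * Rank under base change and substitution *)

Section RankTransport.
Variables (d m : nat) (nu : 'I_d -> nat).

Lemma rank_le_map (R S : comNzRingType) (f : {rmorphism R -> S}) r
  (T : tensor R d m) : rank_le nu r T -> rank_le nu r (map_mpoly f T).
Proof.
move=> [c [l ->]]; exists (fun s => f (c s)), (fun s i => map_mx f (l s i)).
rewrite raddf_sum; apply: eq_bigr => s _ /=.
rewrite map_mpolyZ rmorph_prod; congr (_ *: _); apply: eq_bigr => i _.
by rewrite rmorphXn /= map_lin.
Qed.

Lemma rank_leZ (R : comNzRingType) r a (T : tensor R d m) :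
  rank_le nu r T -> rank_le nu r (a *: T).
Proof.
move=> [c [l ->]]; exists (fun s => a * c s), l.
by rewrite scaler_sumr; apply: eq_bigr => s _; rewrite scalerA.
Qed.

Lemma rank_le_induced (R : comNzRingType) r phi (T : tensor R d m) :
  rank_le nu r T -> rank_le nu r (induced phi T).
Proof.
move=> [c [l ->]]; exists c, (fun s i => l s i *m phi i).
rewrite linear_sum; apply: eq_bigr => s _ /=.
rewrite linearZ /= rmorph_prod; congr (_ *: _); apply: eq_bigr => i _.
by rewrite rmorphXn /= induced_lin.
Qed.

(** A substitution of nonzero determinant can be undone up to a scalar without
    dividing, by the adjugates. *)
Lemma induced_adjugate (R : comNzRingType) phi (T : tensor R d m) :
  T \in pstensor nu ->
  induced (fun i => \adj (phi i)) (induced phi T) =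
  (\prod_(i < d) \det (phi i) ^+ nu i) *: T.
Proof.
move=> hT; rewrite -(induced_scalar _ hT) induced_comp.
by apply: eq_induced => i; rewrite mul_mx_adj.
Qed.

End RankTransport.

Section FractionField.
Variables (A : idomainType) (K : fieldType) (f : {rmorphism A -> K}).
Hypotheses (f_inj : injective f)
  (f_denom : forall (I : finType) (x : I -> K),
     exists2 q : A, q != 0 & exists n : I -> A, forall i, f q * x i = f (n i)).
Variables (d m : nat) (nu : 'I_d -> nat).

Lemma map_mpoly_inj n : injective (map_mpoly f : {mpoly A[n]} -> {mpoly K[n]}).
Proof.
move=> T T' e; apply/mpolyP => a; apply: f_inj.
by rewrite -!mcoeff_map_mpoly e.
Qed.

(** Rank over a field of fractions, stated over the base domain: this form is
    transported by the substitution [t := t ^ e], which is only given on power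
    series. *)
Lemma rank_le_frac r (T : tensor A d m) :
  rank_le nu r (map_mpoly f T) <-> exists2 q, q != 0 & rank_le nu r (q *: T).
Proof.
split=> [[c [l TE]]|[q q0 h]]; last first.
  have := rank_le_map f h.
  rewrite map_mpolyZ => /(rank_leZ (f q)^-1).
  by rewrite scalerA mulVf ?raddf_eq0 // scale1r.
have [q q0 [c' cE]] := f_denom c.
have [q' q'0 [x xE]] := f_denom
  (fun s : 'I_r * 'I_d * 'I_m => l s.1.1 s.1.2 0 s.2).
exists (q * \prod_(i < d) q' ^+ nu i).
  by rewrite mulf_neq0 //; apply/prodf_neq0 => i _; rewrite expf_neq0.
exists c', (fun s i => \row_j x (s, i, j)); apply: map_mpoly_inj.
rewrite map_mpolyZ TE rmorphM rmorph_prod scaler_sumr raddf_sum /=.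
apply: eq_bigr => s _; rewrite map_mpolyZ rmorph_prod scalerA -cE mulrAC.
rewrite -scalerA; congr (_ *: _).
rewrite -scaler_prod; apply: eq_bigr => i _.
rewrite !rmorphXn /= -exprZn map_lin -linearZ /=; congr (lin _ _ ^+ _).
by apply/rowP => j; rewrite !mxE -(xE (s, i, j)).
Qed.

End FractionField.

Lemma rank_le_general (k : fieldType) d m nu r (T : tensor (pseries k) d m) :
  rank_le nu r (general T) <-> exists2 q, q != 0 & rank_le nu r (q *: T).
Proof.
apply: (rank_le_frac (f := @tofrac (pseries k))); last exact: common_denominator.
by move=> x y /eqP; rewrite tofrac_eq => /eqP.
Qed.


Section DiagonalScaling.
Variables (R : comNzRingType) (d m : nat) (r : 'I_d -> nat).

(** The degree in the variables of index at least [r i], the complementary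
    ones when [r i] is the dimension of [W i]. *)
Definition codeg (a : 'X_{1..(nvars d m)}) : nat :=
  (\sum_(i < d) \sum_(j < m | r i <= j) a (vx i j))%N.

(** The scaling of the complementary basis vectors. For [x = t ^ c] it undoes
    the rescaling step, and for [x = 0] it is the projection onto the [W i]. *)
Definition scale_mx (x : R) (i : 'I_d) : 'M[R]_m :=
  diag_mx (\row_j if (r i <= j)%N then x else 1).

Lemma mcoeff_induced_scale x (T : tensor R d m) a :
  (induced (scale_mx x) T)@_a = x ^+ codeg a * T@_a.
Proof.
rewrite {1}[T]mpolyE (linear_sum (induced _)) /= raddf_sum /=.
have monE b : induced (scale_mx x) 'X_[b] = x ^+ codeg b *: 'X_[b] :> tensor R d m.
  rewrite mpolyX_prod_vx rmorph_prod /codeg -prodrXr -scaler_prod.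
  apply: eq_bigr => i _; rewrite rmorph_prod /= [in x ^+ _]big_mkcond /= -prodrXr -scaler_prod.
  apply: eq_bigr => j _; rewrite rmorphXn /= inducedX.
  have -> : row j (scale_mx x i) = (if (r i <= j)%N then x else 1) *: delta_mx 0 j.
    rewrite /scale_mx row_diag_mx mxE; by [].
  rewrite linearZ /= lin_delta exprZn; congr (_ *: _).
  by case: ifP => // _; rewrite expr1n expr0.
under eq_bigr => b _ do rewrite linearZ /= monE !mcoeffZ mcoeffX.
have [Ta|/negP aT] := boolP (a \in msupp T).
  rewrite (bigD1_seq a) ?msupp_uniq //= eqxx mulr1 big1 ?addr0 1?mulrC //.
  by move=> b /negPf ->; rewrite !mulr0.
have -> : T@_a = 0 by apply/memN_msupp_eq0/negP.
rewrite mulr0 big1_seq // => b /= bT; case: eqP => [e|]; last by rewrite !mulr0.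
by case: aT; rewrite -e.
Qed.

Lemma det_scale_mx x i : \det (scale_mx x i) = x ^+ (m - r i).
Proof.
rewrite det_diag; under eq_bigr do rewrite mxE.
rewrite -big_mkcond /= -(big_mkord (fun j => r i <= j)%N (fun=> x)).
by rewrite -(big_nat_widenl _ 0 _ xpredT) // prodr_const_nat.
Qed.

Lemma scale_mx0 i : scale_mx 0 i = pid_mx (r i).
Proof.
apply/matrixP => j l; rewrite !mxE ltnNge; case: leqP => //= _.
  by rewrite mul0rn andbF.
by rewrite andbT.
Qed.

Lemma scale_mx_tr x i : (scale_mx x i)^T = scale_mx x i.
Proof. exact: tr_diag_mx. Qed.

End DiagonalScaling.

Lemma map_scale_mx (R S : comNzRingType) (f : {rmorphism R -> S}) d m
    (r : 'I_d -> nat) x i :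
  map_mx f (scale_mx m r x i) = scale_mx m r (f x) i.
Proof.
by apply/matrixP => j l; rewrite !mxE raddfMn /=; case: ifP; rewrite ?rmorph1.
Qed.

Lemma regular_exponents_laurent (k : fieldType) d (nu : 'I_d -> nat) :
  regular_exponents k nu -> regular_exponents (laurent k) nu.
Proof.
move=> reg i n /(reg i) n0.
have : ps_const (n%:R : k) != 0.
  apply: contra n0 => /eqP/(congr1 (@ps_eval0 k)); rewrite raddf0 => <-.
  by rewrite /ps_eval0.
by rewrite -natr_pseries -(tofrac_eq0) rmorph_nat.
Qed.

Lemma regular_exponents_char (k : fieldType) d (nu : 'I_d -> nat) :
  (forall p, p \in [pchar k] -> forall i, (nu i < p)%N) ->
  regular_exponents k nu.
Proof.
move=> char_k i n /andP[n0 le_n].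
rewrite natf_neq0_pchar; apply/pnatP => // p p_prime pn.
rewrite !inE; apply/negP => /char_k/(_ i).
by apply/negP; rewrite -leqNgt (leq_trans (dvdn_leq n0 pn)).
Qed.

Lemma rank_flattening_induced (F : fieldType) d m nu phi (T : tensor F d m) i :
  T \in pstensor nu ->
  (\rank (flattening nu (induced phi T) i) <= \rank (flattening nu T i))%N.
Proof.
move=> hT; rewrite flattening_induced //.
exact: leq_trans (mxrankM_maxl _ _) (mxrankM_maxr _ _).
Qed.

(** * The rescaling step *)

Section Valuation.
Variable k : fieldType.

Lemma leq_psval_ramify (e c : nat) (f : pseries k) : f != 0 ->
  (c <= e * psval f)%N -> forall n, (n < c)%N -> ps_ramify e f n = 0.
Proof.
move=> f0 le n nc /=; case: ifP => // /dvdnP[q nq].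
have [_ -> //] := psvalP f0; have := leq_trans nc le; rewrite nq mulnC.
by case: (posnP e) => [->|e0]; rewrite ?mul0n // ltn_pmul2l // mulKn.
Qed.

End Valuation.

Section MaxSlope.
Variables (k : fieldType) (d m : nat) (nu : 'I_d -> nat).
Variables (T : tensor k d m) (U : tensor (pseries k) d m).
Local Notation cod := (codegree nu T).
Local Notation slope a := ((psval U@_a)%:R / (cod a)%:R : rat).
Local Notation b := (max_slope nu T U).

Lemma max_slope_ge0 : 0 <= b.
Proof.
rewrite /max_slope; set s := sort _ _.
have : all (fun x : rat => 0 <= x) s.
  rewrite /s all_sort; apply/allP => x /mapP[a _ ->].
  by rewrite divr_ge0 ?ler0n.
by case: s => [|x s] //= /andP[].
Qed.

Lemma max_slope_le a : U@_a != 0 -> (0 < cod a)%N -> b <= slope a.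
Proof.
rewrite -mcoeff_msupp => Ua ca; rewrite /max_slope; set s := sort _ _.
have : slope a \in s by rewrite mem_sort; apply: map_f; rewrite mem_filter ca.
have : sorted <=%R s by apply: sort_sorted; apply: le_total.
case: s => [|x s] //= /(order_path_min le_trans)/allP h.
by rewrite inE => /predU1P[->|/h].
Qed.

Lemma max_slope_attained a : U@_a != 0 -> (0 < cod a)%N ->
  exists a', [/\ U@_a' != 0, (0 < cod a')%N & b = slope a'].
Proof.
rewrite -mcoeff_msupp => Ua ca; rewrite /max_slope; set s := sort _ _.
have sa : slope a \in s by rewrite mem_sort; apply: map_f; rewrite mem_filter ca.
have : head 0 s \in s by case: s sa => [|x s] // _; apply: mem_head.
rewrite {2}/s mem_sort => /mapP[a' + e]; rewrite mem_filter => /andP[ca' Ua'].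
by exists a'; rewrite -mcoeff_msupp.
Qed.

Local Notation c := (absz (numq b)).
Local Notation e := (absz (denq b)).

Lemma max_slopeE : b = c%:R / e%:R.
Proof.
rewrite -[LHS]divq_num_den.
have h (z : int) : 0 <= z -> z%:~R = (absz z)%:R :> rat.
  by case: z.
by rewrite !h // ?numq_ge0 ?max_slope_ge0 // ltW.
Qed.

Lemma absz_denq_gt0 : (0 < e)%N.
Proof. by rewrite absz_gt0 denq_neq0. Qed.

Lemma coprime_slope : coprime c e.
Proof. exact: coprime_num_den. Qed.

(** After [t := t ^ e], every coefficient is divisible by the power of [t] that
    the rescaling by [t ^ (- c)] takes away from it. *)
Lemma slope_num_le a : U@_a != 0 -> (c * cod a <= e * psval U@_a)%N.
Proof.
move=> Ua; have [->|ca] := posnP (cod a); first by rewrite muln0.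
have := max_slope_le Ua ca; rewrite {1}max_slopeE.
rewrite ler_pdivrMr ?ltr0n ?absz_denq_gt0 // mulrAC ler_pdivlMr ?ltr0n //.
by rewrite -!natrM ler_nat [(_ * e)%N]mulnC.
Qed.

Lemma slope_num_attained a : U@_a != 0 -> (0 < cod a)%N ->
  exists a', [/\ U@_a' != 0, (0 < cod a')%N & (c * cod a' = e * psval U@_a')%N].
Proof.
move=> Ua ca; have [a' [Ua' ca' bE]] := max_slope_attained Ua ca.
exists a'; split=> //; apply/eqP; rewrite -(eqr_nat rat) !natrM.
have: c%:R / e%:R = slope a' by rewrite -max_slopeE.
move/eqP; rewrite eqr_div ?pnatr_eq0 -?lt0n ?absz_denq_gt0 //.
by rewrite [e%:R * _]mulrC.
Qed.

(** The shift in [rescale] drops no term. *)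
Lemma mcoeff_rescale a :
  psX k ^+ (c * cod a) * (rescale nu T b U)@_a = ps_ramify e U@_a.
Proof.
have -> : (rescale nu T b U)@_a = ps_shift (c * cod a) (ps_ramify e U@_a).
  rewrite /rescale raddf_sum /=.
  have [Ua|aU] := boolP (a \in msupp U).
    rewrite (bigD1_seq a) ?msupp_uniq //= mcoeffZ mcoeffX eqxx mulr1 big1 ?addr0 //.
    by move=> a' ne; rewrite mcoeffZ mcoeffX (negPf ne) mulr0.
  rewrite (memN_msupp_eq0 aU) big1_seq => [|a' /= Ua'].
    rewrite raddf0; apply/pseriesP => n; rewrite pscoef0.
    by symmetry; apply: pscoef0.
  rewrite mcoeffZ mcoeffX; case: eqP => [e|]; last by rewrite mulr0.
  by rewrite -e Ua' in aU.
have [->|Ua] := eqVneq U@_a 0.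
  by apply: ps_shiftK => n _; rewrite raddf0 pscoef0.
by apply: ps_shiftK; apply: leq_psval_ramify => //; apply: slope_num_le.
Qed.

Lemma induced_rescale :
  induced (scale_mx m (fun i => \rank (span_mx nu T i)) (psX k ^+ c))
    (rescale nu T b U) = map_mpoly (ps_ramify e) U.
Proof.
apply/mpolyP => a; rewrite [RHS]mcoeff_map_mpoly.
apply: etrans (mcoeff_induced_scale _ _ _ _) _; rewrite -exprM.
exact: mcoeff_rescale.
Qed.

Lemma pstensor_rescale : U \in pstensor nu -> rescale nu T b U \in pstensor nu.
Proof.
move=> /pstensorP hU; apply/pstensorP => a Ra; apply: hU.
apply: contraNneq Ra => Ua; have := mcoeff_rescale a; rewrite Ua raddf0.
by move/eqP; rewrite mulf_eq0 (negPf (psXn_neq0 _ _)).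
Qed.

End MaxSlope.

Section Step.
Variables (k : fieldType) (d m : nat) (nu : 'I_d -> nat).
Hypothesis regk : regular_exponents k nu.
Local Notation A := (pseries k).
Local Notation const_mx := (map_mx (@ps_const k)).
Local Notation span_rank T := (fun i => \rank (span_mx nu T i)).

Lemma limitE (T : tensor A d m) : limit T = map_mpoly (@ps_eval0 k) T.
Proof. by []. Qed.

Lemma mcoeff_limit (T : tensor A d m) a : (limit T)@_a = T@_a 0%N.
Proof. by rewrite limitE mcoeff_map_mpoly. Qed.

Lemma pstensor_limit (T : tensor A d m) :
  T \in pstensor nu -> limit T \in pstensor nu.
Proof. exact: (pstensor_map (@ps_eval0 k)). Qed.

Lemma map_eval0_const n p (M : 'M[k]_(n, p)) :
  map_mx (@ps_eval0 k) (map_mx (@ps_const k) M) = M.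
Proof. by apply/matrixP => i j; rewrite !mxE. Qed.

Lemma limit_induced phi (T : tensor A d m) :
  limit (induced phi T) = induced (fun i => map_mx (@ps_eval0 k) (phi i)) (limit T).
Proof. by rewrite !limitE map_induced. Qed.

Lemma limit_induced_const phi (T : tensor A d m) :
  limit (induced (fun i => map_mx (@ps_const k) (phi i)) T) = induced phi (limit T).
Proof. by rewrite limit_induced; apply: eq_induced => i; rewrite map_eval0_const. Qed.

Lemma mcoeff_codeg_eq0 (r : 'I_d -> nat) (U : tensor k d m) a :
  U \in pstensor nu ->
  (forall i (j : 'I_m), (r i <= j)%N -> U^`M(vx i j) = 0) ->
  (0 < codeg r a)%N -> U@_a = 0.
Proof.
move=> hU h; rewrite lt0n sum_nat_eq0 => /forallPn[i] /=.
rewrite sum_nat_eq0 => /forallPn[j]; rewrite negb_imply => /andP[rj].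
by rewrite -lt0n => aj; apply: (mcoeff_mderiv_eq0 regk hU (h i j rj) aj).
Qed.

(** What the proof uses of a step. [U] and [V] are the degenerations before and
    after rescaling, in coordinates adapted to the limit of [Tt], and [B] is the
    adapted basis; [c / e] is the slope. *)
Variant step_spec (Tt Tt' : tensor A d m) : Prop :=
  StepSpec (B : 'I_d -> 'M[k]_m) (U V : tensor A d m) (c e : nat) of
    forall i, B i \in unitmx &
    (0 < e)%N & coprime c e & U \in pstensor nu & V \in pstensor nu &
    Tt = induced (fun i => const_mx (B i)) U &
    Tt' = induced (fun i => const_mx (B i)) V &
    induced (scale_mx m (span_rank (limit Tt)) (psX k ^+ c)) V =
      map_mpoly (ps_ramify e) U &
    (forall i (j : 'I_m), (span_rank (limit Tt) i <= j)%N ->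
       (limit U)^`M(vx i j) = 0) &
    (forall a, U@_a != 0 -> (0 < codeg (span_rank (limit Tt)) a)%N ->
      (0 < c)%N /\ exists2 a', (0 < codeg (span_rank (limit Tt)) a')%N &
                     (limit V)@_a' != 0) &
    (forall i, exists2 C, C \in unitmx & 
       span_mx nu (limit Tt) i = C *m pid_mx (span_rank (limit Tt) i) *m B i).

(** The slope is attained at some monomial with a positive codegree; its
    coefficient survives in the limit of [V]. The slope is positive because
    coefficients of positive codegree vanish at [t = 0]. *)
Lemma unrestriction_stepP Tt : Tt \in pstensor nu ->
  step_spec Tt (unrestriction_step nu Tt).
Proof.
move=> hTt; pose T := limit Tt; have hT : T \in pstensor nu by exact: pstensor_limit.
pose B i := adapted_basis nu T i.
pose U := induced (fun i => const_mx (invmx (B i))) Tt.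
have hU : U \in pstensor nu by exact: pstensor_induced.
have limU i (j : 'I_m) : (span_rank T i <= j)%N -> (limit U)^`M(vx i j) = 0.
  rewrite limit_induced_const; exact: adapted_mderiv_eq0.
have unitB i : B i \in unitmx by exact: row_ebase_unit.
have TtE : Tt = induced (fun i => const_mx (B i)) U.
  rewrite /U induced_comp -[LHS]induced1; apply: eq_induced => i.
  by rewrite -map_mxM mulVmx // map_mx1.
have spanE i : exists2 C, C \in unitmx &
    span_mx nu T i = C *m pid_mx (span_rank T i) *m B i.
  exists (col_ebase (span_mx nu T i)); first exact: col_ebase_unit.
  by rewrite mulmx_ebase.
pose b := max_slope nu T U.
pose V := rescale nu T b U.
have stepE : unrestriction_step nu Tt = induced (fun i => const_mx (B i)) V.
  exact: erefl.
have hV : V \in pstensor nu by exact: pstensor_rescale.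
have e_gt0 : (0 < absz (denq b))%N by exact: absz_denq_gt0.
have co : coprime (absz (numq b)) (absz (denq b)) by exact: coprime_slope.
have VE := induced_rescale nu T U.
have VaE := mcoeff_rescale nu T U.
have att := @slope_num_attained _ _ _ nu T U.
rewrite -/b -/V in VE VaE att.
move: (absz (numq b)) (absz (denq b)) e_gt0 co VE VaE att => c e.
rewrite stepE => e_gt0 co; clearbody V => {b stepE} VE VaE att.
clearbody U.
refine (StepSpec unitB e_gt0 co hU hV TtE (erefl _) VE limU _ spanE) => a Ua ca.
have [a' [Ua' ca' E]] := att a Ua ca.
have limUa : U@_a' 0%N = 0.
  rewrite -mcoeff_limit; exact: (mcoeff_codeg_eq0 (pstensor_limit hU) limU ca').
have [Uv _] := psvalP Ua'.
have v_gt0 : (0 < psval U@_a')%N.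
  by rewrite lt0n; apply: contraNneq Uv => ->; rewrite limUa.
split.
  have : (0 < c * codegree nu T a')%N by rewrite E muln_gt0 e_gt0.
  by rewrite muln_gt0 => /andP[].
exists a'; first exact: ca'.
rewrite mcoeff_limit.
have := pscoef_XnM (c * codegree nu T a') V@_a' (c * codegree nu T a')%N.
rewrite ltnn subnn VaE => <-.
by rewrite E mulnC ps_ramify_mul.
Qed.

End Step.

(** * Nondegeneracy of the general tensor *)

Lemma det_flattening_base_change (R S : comNzRingType) (f : {rmorphism R -> S}) d m nu
    (T : tensor R d m) T' Theta i G :
  T' \in pstensor nu -> map_mpoly f T = induced Theta T' ->
  f (\det (flattening nu T i *m G)) = \det (Theta i) *
    \det (flattening nu T' i *m (induced_mx nu Theta *m map_mx f G)).
Proof.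
move=> hT' E; rewrite -det_map_mx map_mxM -flattening_map E flattening_induced //.
by rewrite -!mulmxA det_mulmx det_tr.
Qed.

Lemma rank_le_descend (R S : idomainType) (f : {rmorphism R -> S}) d m nu
    (T : tensor R d m) T' Theta r :
    injective f -> T' \in pstensor nu -> map_mpoly f T = induced Theta T' ->
    (forall i, \det (Theta i) != 0) ->
    (exists2 q, q != 0 & rank_le nu r (q *: T)) ->
  exists2 q, q != 0 & rank_le nu r (q *: T').
Proof.
move=> f_inj hT' E detT [q q0 hq].
exists (f q * \prod_(i < d) \det (Theta i) ^+ nu i).
  rewrite mulf_neq0 ?raddf_eq0 //.
  by apply/prodf_neq0 => i _; rewrite expf_neq0.
have := rank_le_induced (fun i => \adj (Theta i)) (rank_le_map f hq).
by rewrite map_mpolyZ linearZ /= E (induced_adjugate _ hT') scalerA.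
Qed.

Section Consequences.
Variables (k : fieldType) (d m : nat) (nu : 'I_d -> nat).
Hypothesis regk : regular_exponents k nu.
Local Notation A := (pseries k).
Local Notation const_mx := (map_mx (@ps_const k)).
Local Notation span_rank T := (fun i => \rank (span_mx nu T i)).
Local Notation K := #|{: 'X_{1..(nvars d m) < \sum_(i < d) nu i}}|.

(** The general tensor is concise when these determinants are nonzero. The
    matrices [G] are arbitrary, rather than selections of columns, because a
    step multiplies flattenings on the right by a matrix. The coefficient [n]
    need not be the lowest one; it is the quantity that decreases. *)
Definition nondeg_at (Tt : tensor A d m) (n : nat) : Prop :=
  exists G : 'I_d -> 'M[A]_(K, m),
    (\prod_(i < d) \det (flattening nu Tt i *m G i)) n != 0.

Lemma nondeg_contract_inj (Tt : tensor A d m) n i (f : 'rV[A]_m) : nondeg_at Tt n ->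
  f *m flattening nu Tt i = 0 -> f = 0.
Proof.
move=> [G Gn] fF; apply/eqP/contraT => f0; case/eqP: Gn.
suff -> : \prod_(i < d) \det (flattening nu Tt i *m G i) = 0 by rewrite pscoef0.
apply/eqP/prodf_eq0; exists i => //.
by apply/det0P; exists f => //; rewrite mulmxA fF mul0mx.
Qed.

(** The witness for [Tt'] is the witness for [Tt] divided by the determinants of
    the [Theta i]. *)
Lemma nondeg_ramify (Tt Tt' : tensor A d m) e Theta C n :
    Tt' \in pstensor nu ->
    map_mpoly (ps_ramify e) Tt = induced Theta Tt' ->
    \prod_(i < d) \det (Theta i) = psX k ^+ C ->
    nondeg_at Tt n ->
  exists P P' : A, [/\ P n != 0, ps_ramify e P = psX k ^+ C * P' &
    forall n', P' n' != 0 -> nondeg_at Tt' n'].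
Proof.
move=> hTt' E detT [G Gn].
pose G' i := induced_mx nu Theta *m map_mx (@ps_ramify k e) (G i).
exists (\prod_(i < d) \det (flattening nu Tt i *m G i)).
exists (\prod_(i < d) \det (flattening nu Tt' i *m G' i)); split.
- exact: Gn.
- rewrite rmorph_prod -detT -big_split /=; apply: eq_bigr => i _.
  exact: det_flattening_base_change hTt' E.
- by move=> n' h; exists G'.
Qed.

Lemma rank_le_ramify (Tt Tt' : tensor A d m) e Theta r :
    (0 < e)%N -> Tt' \in pstensor nu ->
    map_mpoly (ps_ramify e) Tt = induced Theta Tt' ->
    (forall i, \det (Theta i) != 0) ->
  rank_le nu r (general Tt) -> rank_le nu r (general Tt').
Proof.
move=> e0 hTt' E detT /rank_le_general h; apply/rank_le_general.
exact: (rank_le_descend (ps_ramify_inj e0) hTt' E detT h).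
Qed.

End Consequences.

(** * Steps that leave the dimensions unchanged *)

Lemma codeg_addU d m (r : 'I_d -> nat) (a : 'X_{1..(nvars d m)}) i (j : 'I_m) :
  (r i <= j)%N -> codeg r (a + U_(vx i j))%MM = (codeg r a).+1.
Proof.
move=> rj; rewrite /codeg (bigD1 i) //= [in RHS](bigD1 i) //= -addSn.
congr (_ + _)%N; last first.
  apply: eq_bigr => i' ne; apply: eq_bigr => j' _.
  by rewrite mnmDE mnm1E vx_eq eq_sym (negPf ne) addn0.
rewrite (bigD1 j) //= [in RHS](bigD1 j) //= -addSn; congr (_ + _)%N.
  by rewrite mnmDE mnm1E eqxx addn1.
apply: eq_bigr => j' /andP[_ ne].
by rewrite mnmDE mnm1E vx_eq [j == _]eq_sym (negPf ne) andbF addn0.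
Qed.

Section Stagnation.
Variables (F : fieldType) (d m : nat) (nu : 'I_d -> nat).
Hypothesis regF : regular_exponents F nu.
Variables (T V : tensor F d m) (B : 'I_d -> 'M[F]_m).
Local Notation r := (fun i => \rank (span_mx nu T i)).
Hypotheses (hT : T \in pstensor nu) (hV : V \in pstensor nu)
  (unitB : forall i, B i \in unitmx)
  (TE : T = induced B (induced (scale_mx m r 0) V))
  (spanE : forall i, exists2 C, C \in unitmx &
       span_mx nu T i = C *m pid_mx (r i) *m B i)
  (rankE : forall i, \rank (span_mx nu (induced B V) i) = r i).

(** Suppose that [V], whose codegree 0 part spans the [W i], has no term of
    codegree one. A functional [f] that contracts [V] to zero then contracts the
    codegree 0 part to zero, so it vanishes on [W i]. As [V] spans spaces of the
    same dimensions as its codegree 0 part, all functionals vanishing on [W i]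
    contract [V] to zero, and [V] has no term of positive codegree at all. *)
Lemma stagnation_codegree_one a : (0 < codeg r a)%N -> V@_a != 0 ->
  exists2 a', codeg r a' = 1%N & V@_a' != 0.
Proof.
move=> ca Va; apply: contrapT => no1.
have V1 a' : codeg r a' = 1%N -> V@_a' = 0.
  by move=> c1; apply/eqP/negPn/negP => Va'; apply: no1; exists a'.
case/eqP: Va; apply: (mcoeff_codeg_eq0 regF hV _ ca) => i j rj {a ca}.
pose P := scale_mx m r (0 : F).
have PE : P i = pid_mx (r i) by exact: scale_mx0.
have PP : P i *m P i = P i.
  by rewrite PE mul_pid_mx minnn; congr pid_mx; apply/minn_idPr; exact: rank_leq_row.
(* A derivative along a complementary direction has its codegree 0 part
   made of coefficients of codegree 1, which are assumed to vanish. *)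
have P_mderiv (l : 'I_m) : (r i <= l)%N -> induced P V^`M(vx i l) = 0.
  move=> rl; apply/mpolyP => a; rewrite mcoeff_induced_scale mcoeff0 mcoeff_mderiv.
  have [c0|c0] := posnP (codeg r a); last by rewrite expr0n gtn_eqF // mul0r.
  by rewrite V1 ?mul0rn ?mulr0 // codeg_addU // c0.
have key (f : 'rV[F]_m) : contract i f V = 0 -> f *m P i = 0.
  move=> fV; pose g := f *m P i.
  have gU : contract i g (induced P V) = 0.
    rewrite contract_induced scale_mx_tr -mulmxA PP.
    have -> : f *m P i = f - f *m (1%:M - P i) by rewrite mulmxBr mulmx1 subKr.
    rewrite contractBl fV sub0r.
    rewrite linearN /=; apply/eqP; rewrite oppr_eq0; apply/eqP.
    rewrite /contract (linear_sum (induced P)) /= big1 // => l _.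
    rewrite linearZ /=; have [lr|rl] := ltnP l (r i); last by rewrite P_mderiv ?scaler0.
    have -> : (f *m (1%:M - P i)) 0 l = 0; last by rewrite scale0r.
    rewrite mxE big1 // => s _; rewrite PE !mxE -(val_eqE s l) /=.
    by case: eqP => [->|_]; rewrite ?lr ?subrr ?subr0 mulr0.
  have gT : contract i (g *m (invmx (B i))^T) T = 0.
    rewrite TE contract_induced -mulmxA -trmx_mul mulmxV // trmx1 mulmx1.
    by rewrite gU linear0.
  move/eqP: gT; rewrite -(span_mx_contract regF) // trmx_mul trmxK.
  have [C unitC ->] := spanE i.
  rewrite mulmxA -[_ *m B i *m _]mulmxA mulmxV // mulmx1 -mulmxA -PE.
  rewrite -trmx_eq0 !trmx_mul trmxK !scale_mx_tr.
  rewrite -[f *m _ *m _]mulmxA (PP : scale_mx m r 0 i *m scale_mx m r 0 i = _).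
  rewrite -/g => /eqP gC.
  by rewrite -[LHS]mulmx1 -trmx1 -(mulVmx unitC) trmx_mul mulmxA gC mul0mx.
have kerF : (kermx (flattening nu V i) <= kermx (P i))%MS.
  apply/row_subP => s; rewrite sub_kermx; apply/eqP/key.
  by apply/(contract_eq0 _ _ hV)/eqP; rewrite -sub_kermx row_sub.
have rankV : (\rank (flattening nu V i) <= r i)%N.
  rewrite -rankE (rank_span_mx regF) ?pstensor_induced //.
  have VE : V = induced (fun i => invmx (B i)) (induced B V).
    rewrite induced_comp -[LHS]induced1; apply: eq_induced => s.
    by rewrite mulmxV.
  rewrite {1}VE; apply: rank_flattening_induced; exact: pstensor_induced.
have kerP : (kermx (P i) <= kermx (flattening nu V i))%MS.
  rewrite -(geq_leqif (mxrank_leqif_sup kerF)) !mxrank_ker leq_sub2l //.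
  by rewrite PE rank_pid_mx ?rank_leq_row.
rewrite -contract_delta; apply/(contract_eq0 _ _ hV)/eqP.
rewrite -sub_kermx; apply: submx_trans kerP; rewrite sub_kermx PE.
apply/eqP/rowP => s; rewrite -rowE !mxE.
by rewrite ltnNge rj andbF.
Qed.

End Stagnation.

(** * Progress made by a step *)

Lemma map_mxmulV (R : comUnitRingType) (S : comNzRingType) (f : {rmorphism R -> S})
    n (M : 'M[R]_n) : M \in unitmx -> map_mx f M *m map_mx f (invmx M) = 1%:M.
Proof. by move=> uM; rewrite -map_mxM mulmxV // map_mx1. Qed.

Lemma map_mxmulVmx (R : comUnitRingType) (S : comNzRingType) (f : {rmorphism R -> S})
    n (M : 'M[R]_n) : M \in unitmx -> map_mx f (invmx M) *m map_mx f M = 1%:M.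
Proof. by move=> uM; rewrite -map_mxM mulVmx // map_mx1. Qed.

Lemma induced_conjugate (R S : comNzRingType) (f : {rmorphism R -> S}) d m
    (B : 'I_d -> 'M[R]_m) (B1 B2 D : 'I_d -> 'M[S]_m) (T U : tensor R d m) V :
    (forall i, map_mx f (B i) = B1 i) -> (forall i, B1 i *m B2 i = 1%:M) ->
    T = induced B U -> map_mpoly f U = induced D V ->
  map_mpoly f T = induced (fun i => B2 i *m D i *m B1 i) (induced B1 V).
Proof.
move=> fB B12 -> fU; rewrite map_induced fU !induced_comp.
by apply: eq_induced => i; rewrite fB -mulmxA mulmxA B12 mul1mx.
Qed.

Lemma sum_gap_gt0 d m (r : 'I_d -> nat) c i :
  (0 < c)%N -> (r i < m)%N -> (0 < \sum_(i < d) c * (m - r i))%N.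
Proof.
by move=> c_gt0 ri; rewrite (bigD1 i) //= addn_gt0 muln_gt0 c_gt0 subn_gt0 ri.
Qed.

Section Progress.
Variables (k : fieldType) (d m : nat) (nu : 'I_d -> nat).
Hypothesis regk : regular_exponents k nu.
Local Notation A := (pseries k).
Local Notation const_mx := (map_mx (@ps_const k)).
Local Notation span_rank T := (fun i => \rank (span_mx nu T i)).

Lemma limit_ramify e (T : tensor A d m) :
  limit (map_mpoly (ps_ramify e) T) = limit T.
Proof.
apply/mpolyP => a; rewrite !mcoeff_limit mcoeff_map_mpoly.
exact: (ps_ramify_eval0 e T@_a).
Qed.

(** If no monomial of positive codegree occurs, the degeneration itself stays in
    a proper subtensor space, against the nondegeneracy. *)
Lemma codeg_exists (Tt U : tensor A d m) (B : 'I_d -> 'M[k]_m) r n i :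
    Tt \in pstensor nu -> (forall i, B i \in unitmx) ->
    Tt = induced (fun i => const_mx (B i)) U ->
    nondeg_at nu Tt n -> (r i < m)%N ->
  exists2 a, U@_a != 0 & (0 < codeg r a)%N.
Proof.
move=> hTt unitB TtE nd ri; apply: contrapT => no.
pose j := Ordinal ri.
have dU : U^`M(vx i j) = 0.
  apply/mpolyP => a; rewrite mcoeff_mderiv mcoeff0.
  have [->|Ua] := eqVneq U@_(a + U_(vx i j)) 0; first by rewrite mul0rn.
  by case: no; exists (a + U_(vx i j))%MM => //; rewrite codeg_addU.
pose g : 'rV[A]_m := delta_mx 0 j *m (const_mx (invmx (B i)))^T.
have gB : g *m (const_mx (B i))^T = delta_mx 0 j.
  by rewrite -mulmxA -trmx_mul map_mxmulV // trmx1 mulmx1.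
have : g = 0.
  apply: (nondeg_contract_inj (i := i) nd); apply/(contract_eq0 _ _ hTt).
  rewrite TtE contract_induced; cbv beta.
  by rewrite gB contract_delta dU; exact: linear0.
move=> g0; move: gB; rewrite g0 mul0mx => /rowP/(_ j); rewrite !mxE !eqxx.
by move/esym/eqP; rewrite oner_eq0.
Qed.

(** The last item is the termination measure: if the limit is not concise,
    either some dimension grows or the degree [n] of the witness drops. In the
    former case no relation between [n'] and [n] is claimed, since the
    substitution [t := t ^ e] may increase the degree. *)
Lemma step_progress (Tt Tt' : tensor A d m) :
    Tt \in pstensor nu -> step_spec nu Tt Tt' ->
  [/\ Tt' \in pstensor nu, is_restriction (limit Tt) (limit Tt'),
      forall i, (span_rank (limit Tt) i <= span_rank (limit Tt') i)%N,
      forall r, rank_le nu r (general Tt) -> rank_le nu r (general Tt')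
    & forall n, nondeg_at nu Tt n -> exists2 n', nondeg_at nu Tt' n' &
        forall i, (span_rank (limit Tt) i < m)%N ->
        (forall i, span_rank (limit Tt') i = span_rank (limit Tt) i) ->
        (n' < n)%N].
Proof.
move=> hTt [B U V c e unitB e_gt0 co hU hV TtE TtE' VE limU att spanE].
pose r := span_rank (limit Tt).
pose Theta i := const_mx (invmx (B i)) *m scale_mx m r (psX k ^+ c) i *m const_mx (B i).
have hTt' : Tt' \in pstensor nu by rewrite TtE'; exact: pstensor_induced.
have BV i : const_mx (B i) *m const_mx (invmx (B i)) = 1%:M.
  exact: map_mxmulV (unitB i).
have rho_Tt : map_mpoly (ps_ramify e) Tt = induced Theta Tt'.
  rewrite TtE'; apply: induced_conjugate BV TtE (esym VE) => i.
  by apply/matrixP => j l; rewrite !mxE; exact: ps_ramify_const.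
have detTheta i : \det (Theta i) = psX k ^+ (c * (m - r i)).
  rewrite /Theta !det_mulmx mulrAC mulrC -det_mulmx.
  have -> : const_mx (invmx (B i)) *m const_mx (B i) = 1%:M.
    exact: map_mxmulVmx (unitB i).
  by rewrite det1 mulr1 det_scale_mx exprM.
have limTt : limit Tt = induced (fun i => map_mx (@ps_eval0 k) (Theta i)) (limit Tt').
  by rewrite -limit_induced -rho_Tt limit_ramify.
split.
- exact: hTt'.
- by exists (fun i => map_mx (@ps_eval0 k) (Theta i)); rewrite -limTt.
- move=> i; rewrite (rank_span_mx regk i (pstensor_limit hTt)).
  rewrite (rank_span_mx regk i (pstensor_limit hTt')) limTt.
  exact: rank_flattening_induced (pstensor_limit hTt').
- move=> s; apply: (rank_le_ramify e_gt0 hTt' rho_Tt) => i.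
  rewrite detTheta; exact: psXn_neq0.
move=> n nd.
have detC : \prod_(i < d) \det (Theta i) = psX k ^+ (\sum_(i < d) c * (m - r i)).
  by rewrite -prodrXr; apply: eq_bigr => i _; rewrite detTheta.
have [P [P' [Pn PE ndP']]] := nondeg_ramify hTt' rho_Tt detC nd.
(* [P] and [P'] are the witnesses before and after the step. *)
have P'_neq0 : P' != 0.
  have : P != 0 by apply: contraNneq Pn => ->; rewrite pscoef0.
  apply: contraNneq => P'0; apply/eqP/(ps_ramify_inj e_gt0).
  by rewrite PE P'0 mulr0 raddf0.
have [/existsP[i ri]|full] := boolP [exists i, (r i < m)%N]; last first.
  have [n' Pn'] := pscoef_neq0 P'_neq0; exists n'; first exact: ndP'.
  by move=> i ri; case/negP: full; apply/existsP; exists i.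
have [stag|nostag] := boolP [forall i, span_rank (limit Tt') i == r i]; last first.
  have [n' Pn'] := pscoef_neq0 P'_neq0; exists n'; first exact: ndP'.
  move=> _ _ h; case/negP: nostag; apply/forallP => i'; exact/eqP/h.
have [a Ua ca] := codeg_exists hTt unitB TtE nd ri.
have [c_gt0 [a' ca' Va']] := att a Ua ca.
have X0 : ps_eval0 (psX k ^+ c) = 0.
  by rewrite -[psX k ^+ c]mulr1 /ps_eval0 pscoef_XnM c_gt0.
have limE : limit Tt = induced B (induced (scale_mx m r 0) (limit V)).
  rewrite {1}TtE limit_induced_const -[limit U](limit_ramify e) -VE limit_induced.
  congr (induced B _); apply: eq_induced => i'.
  by rewrite map_scale_mx; congr (scale_mx m r _ i'); exact: X0.
have rankE i' : \rank (span_mx nu (induced B (limit V)) i') = r i'.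
  by rewrite -limit_induced_const -TtE'; apply/eqP/(forallP stag).
have [a1 c1 Va1] := stagnation_codegree_one regk (pstensor_limit hTt) (pstensor_limit hV)
  unitB limE spanE rankE ca' Va'.
(* The coefficient of [a1] in [U (t ^ e)] has a term of degree [c], so [e]
   divides [c], to which it is prime. *)
have e1 : e = 1%N.
  have E : psX k ^+ c ^+ codeg r a1 * V@_a1 = ps_ramify e U@_a1.
    apply: etrans (esym (mcoeff_induced_scale _ _ V a1)) _; rewrite VE.
    exact: (mcoeff_map_mpoly (@ps_ramify k e)).
  rewrite c1 expr1 in E.
  have := pscoef_XnM c V@_a1 c; rewrite E ltnn subnn -mcoeff_limit => Ec.
  move: Va1; rewrite -Ec /=; case: ifP => [ec _|_]; last by rewrite eqxx.
  by move: co; rewrite /coprime; move/gcdn_idPr: ec => -> /eqP.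
rewrite e1 ps_ramify1 in PE; move: Pn; rewrite PE pscoef_XnM.
case: ltnP => [_|Cn Pn]; first by rewrite eqxx.
exists (n - \sum_(i < d) c * (m - r i))%N; first exact: ndP'.
have C_gt0 := sum_gap_gt0 c_gt0 ri.
by move=> _ _ _; rewrite ltn_subrL C_gt0 (leq_trans C_gt0 Cn).
Qed.

End Progress.

(** * Concise degenerations of tensors of border rank m *)

Section DiagonalTensor.
Variables (R : idomainType) (d m : nat) (nu : 'I_d -> nat).
Hypotheses (nu_neq0 : forall i, (nu i)%:R != 0 :> R)
  (nu_ge2 : (1 < \sum_(i < d) nu i)%N).
Local Notation N := (\sum_(i < d) nu i)%N.
Local Notation K := #|{: 'X_{1..(nvars d m) < N}}|.

Definition diag_tensor (c : 'I_m -> R) : tensor R d m :=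
  \sum_(s < m) c s *: \prod_(i < d) 'X_(vx i s) ^+ nu i.

Definition diag_mnm (s : 'I_m) : 'X_{1..(nvars d m)} :=
  (\sum_(i < d) U_(vx i s) *+ nu i)%MM.

Lemma diag_mnmE s i j : diag_mnm s (vx i j) = ((j == s) * nu i)%N.
Proof.
rewrite /diag_mnm mnm_sumE (bigD1 i) //= mulmnE mnm1E vx_eq eqxx /= eq_sym.
rewrite big1 ?addn0 // => i' ne.
by rewrite mulmnE mnm1E vx_eq (negPf ne).
Qed.

Lemma diag_tensorE c : diag_tensor c = \sum_(s < m) c s *: 'X_[diag_mnm s].
Proof.
apply: eq_bigr => s _; congr (_ *: _); rewrite /diag_mnm -mprodXE.
by apply: eq_bigr => i _; rewrite mpolyXn.
Qed.

Lemma pstensor_diag c : diag_tensor c \in pstensor nu.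
Proof.
rewrite diag_tensorE; apply: pstensor_sum => s _; apply: pstensorZ.
apply/pstensorP => a; rewrite mcoeffX; have [<- _ i|_] := eqVneq (diag_mnm s) a; last by rewrite eqxx.
rewrite (bigD1 s) //= diag_mnmE eqxx mul1n big1 ?addn0 // => j ne.
by rewrite diag_mnmE (negPf ne).
Qed.

Lemma exists_nu_gt0 : exists i, (0 < nu i)%N.
Proof.
apply/existsP; apply: contraLR nu_ge2 => /existsPn h; rewrite big1 // => i _.
by apply/eqP; have := h i; rewrite lt0n negbK.
Qed.

(** Reading the flattening of a diagonal tensor on the derivatives
    [diag_mnm s - U_(vx i s)] of its monomials gives a diagonal matrix. These
    monomials have positive degree, as the exponents add up to at least [2], so
    each of them remembers [s]. *)
Lemma mcoeff_diag_mderiv c i j s :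
  ((diag_tensor c)^`M(vx i j))@_(diag_mnm s - U_(vx i s)) =
  (c s * (nu i)%:R) *+ (j == s).
Proof.
have nu_gt0 : (0 < nu i)%N by rewrite lt0n; apply: contraNneq (nu_neq0 i) => ->.
have le : (U_(vx i s) <= diag_mnm s)%MM by rewrite lep1mP diag_mnmE eqxx mul1n -lt0n.
rewrite mcoeff_mderiv diag_tensorE raddf_sum /=.
under eq_bigr do rewrite mcoeffZ mcoeffX.
have [->|ne] := eqVneq j s.
  rewrite submK // (bigD1 s) //= eqxx mulr1 big1 ?addr0 => [|s' ne].
    by rewrite mnmBE mnm1E eqxx diag_mnmE eqxx mul1n subn1 prednK // mulr_natr.
  case: eqP => [/mnmP e|]; last by rewrite mulr0.
  have [i' nu_i'] := exists_nu_gt0.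
  have := e (vx i' s'); rewrite !diag_mnmE eqxx (negPf ne) mul0n mul1n => e0.
  by rewrite e0 in nu_i'.
rewrite big1 ?mul0rn // => s' _; case: eqP => [/mnmP e|]; last by rewrite mulr0.
have := e (vx i j); rewrite diag_mnmE mnmDE mnm1E eqxx addn1.
have [js'|_] := eqVneq j s'; last by rewrite mul0n.
move=> _; have ne' : s' == s = false by rewrite -js' (negPf ne).
have [i' lt_i'] : exists i', (0 < (diag_mnm s - U_(vx i s))%MM (vx i' s))%N.
  have [nu1|nu1] := ltnP 1 (nu i).
    by exists i; rewrite mnmBE mnm1E eqxx diag_mnmE eqxx mul1n subn_gt0.
  have : (0 < \sum_(i' < d | i' != i) nu i')%N.
    have := nu_ge2; rewrite (bigD1 i) //= => h.
    by rewrite -(ltn_add2l 1) addn0 (leq_trans h) // leq_add2r.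
  rewrite lt0n sum_nat_eq0 => /forallPn[i']; rewrite negb_imply => /andP[ne_i nu_i'].
  exists i'; rewrite mnmBE mnm1E vx_eq eq_sym (negPf ne_i) subn0 diag_mnmE eqxx.
  by rewrite mul1n lt0n.
have := e (vx i' s); rewrite diag_mnmE eq_sym ne' mul0n mnmDE => /eqP.
by rewrite eq_sym addn_eq0 => /andP[/eqP e0]; rewrite e0 in lt_i'.
Qed.

Lemma nondeg_diag c i : (forall s, c s != 0) ->
  exists G : 'M[R]_(K, m), \det (flattening nu (diag_tensor c) i *m G) != 0.
Proof.
move=> c0.
have lt s : (mdeg (diag_mnm s - U_(vx i s))%MM < N)%N.
  have -> : N = mdeg (diag_mnm s).
    rewrite mdeg_sum; apply: eq_bigr => i' _.
    by rewrite mdegMn mdeg1 mul1n.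
  have le : (U_(vx i s) <= diag_mnm s)%MM.
    rewrite lep1mP diag_mnmE eqxx mul1n.
    by apply: contraNneq (nu_neq0 i) => ->.
  by rewrite -{2}(submK le) mdegD mdeg1 addn1.
pose b s := enum_rank (BMultinom (lt s)).
exists (\matrix_(b', s) (b' == b s)%:R).
have -> : flattening nu (diag_tensor c) i *m \matrix_(b', s) (b' == b s)%:R =
    diag_mx (\row_s (c s * (nu i)%:R)).
  apply/matrixP => j s; rewrite !mxE (bigD1 (b s)) //= !mxE eqxx mulr1.
  rewrite [X in _ + X]big1 ?addr0 => [|b' ne]; last by rewrite !mxE (negPf ne) mulr0.
  have -> : (enum_val (b s) : 'X_{1..(nvars d m) < N}) = BMultinom (lt s).
    exact: enum_rankK.
  by rewrite mcoeff_diag_mderiv; case: eqP => [->|].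
rewrite det_diag; apply/prodf_neq0 => s _; rewrite mxE; exact: mulf_neq0.
Qed.

End DiagonalTensor.

Section Perturbation.
Variables (R : idomainType) (d m : nat) (nu : 'I_d -> nat).

(** Congruence modulo the multiples of [q]. *)
Definition eq_upto n (q : R) (p p' : {mpoly R[n]}) :=
  exists D, p' = p + q *: D.

Lemma eq_uptoD n q (p p' u u' : {mpoly R[n]}) :
  eq_upto q p p' -> eq_upto q u u' -> eq_upto q (p + u) (p' + u').
Proof. by move=> [D ->] [E ->]; exists (D + E); rewrite scalerDr addrACA. Qed.

Lemma eq_uptoM n q (p p' u u' : {mpoly R[n]}) :
  eq_upto q p p' -> eq_upto q u u' -> eq_upto q (p * u) (p' * u').
Proof.
move=> [D ->] [E ->]; exists (D * u + p * E + q *: (D * E)).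
rewrite mulrDl !mulrDr !scalerDr -!scalerAl -!scalerAr -!addrA; congr (_ + _).
by rewrite addrCA.
Qed.

Lemma eq_upto_refl n q (p : {mpoly R[n]}) : eq_upto q p p.
Proof. by exists 0; rewrite scaler0 addr0. Qed.

Lemma eq_upto_sum n q (I : Type) (r : seq I) (F G : I -> {mpoly R[n]}) :
  (forall s, eq_upto q (F s) (G s)) ->
  eq_upto q (\sum_(s <- r) F s) (\sum_(s <- r) G s).
Proof.
move=> h; elim: r => [|s r IH]; rewrite ?big_nil ?big_cons; first exact: eq_upto_refl.
exact: eq_uptoD.
Qed.

Lemma eq_upto_prod n q (I : Type) (r : seq I) (F G : I -> {mpoly R[n]}) :
  (forall s, eq_upto q (F s) (G s)) ->
  eq_upto q (\prod_(s <- r) F s) (\prod_(s <- r) G s).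
Proof.
move=> h; elim: r => [|s r IH]; rewrite ?big_nil ?big_cons; first exact: eq_upto_refl.
exact: eq_uptoM.
Qed.

Lemma eq_uptoX n q (p p' : {mpoly R[n]}) l :
  eq_upto q p p' -> eq_upto q (p ^+ l) (p' ^+ l).
Proof.
move=> h; elim: l => [|l IH]; first exact: eq_upto_refl.
by rewrite !exprS; apply: eq_uptoM.
Qed.

(** The determinant is the value at [y j] of a characteristic polynomial, which
    has finitely many roots. *)
Lemma exists_det_neq0 (n : nat) (M : 'M[R]_n) (y : nat -> R) : injective y ->
  exists j, \det ((y j)%:M + M) != 0.
Proof.
move=> inj_y; apply: contrapT => no.
have rootM j : root (char_poly (- M)) (y j).
  rewrite /root; have -> : (char_poly (- M)).[y j] = \det ((y j)%:M + M).
    rewrite /char_poly -horner_evalE -det_map_mx.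
    congr (\det _); apply/matrixP => a b.
    by rewrite !mxE /= horner_evalE hornerD hornerN hornerC hornerMn hornerX opprK.
  by apply/negPn/negP => h; apply: no; exists j.
have := @max_poly_roots _ (char_poly (- M)) [seq y j | j <- iota 0 n.+1].
rewrite map_inj_uniq // iota_uniq size_map size_iota size_char_poly ltnn.
move=> h; have // : false; apply: h => //.
  by rewrite -size_poly_eq0 size_char_poly.
by apply/allP => x /mapP[j _ ->].
Qed.

End Perturbation.

Section Perturb.
Variables (R : idomainType) (d m : nat) (nu : 'I_d -> nat).
Hypotheses (nu_neq0 : forall i, (nu i)%:R != 0 :> R)
  (nu_ge2 : (1 < \sum_(i < d) nu i)%N).
Local Notation K := #|{: 'X_{1..(nvars d m) < \sum_(i < d) nu i}}|.

Lemma pstensorZ_inv q (T : tensor R d m) :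
  q != 0 -> q *: T \in pstensor nu -> T \in pstensor nu.
Proof.
move=> q0 /pstensorP h; apply/pstensorP => a Ta; apply: h.
by rewrite mcoeffZ mulf_neq0.
Qed.

Lemma induced_diag (L : 'I_d -> 'M[R]_m) c :
  induced L (diag_tensor nu c) =
  \sum_(s < m) c s *: \prod_(i < d) lin i (row s (L i)) ^+ nu i.
Proof.
rewrite (linear_sum (induced L)); apply: eq_bigr => s _ /=.
rewrite linearZ /= rmorph_prod; congr (_ *: _); apply: eq_bigr => i _.
by rewrite rmorphXn /= inducedX.
Qed.

(** The perturbation is by multiples of [q * x], where [q] is the denominator of
    the decomposition: after division by [q] the tensor changes only by a
    multiple of [x]. *)
Lemma perturb_nondegenerate (T : tensor R d m) q x :
    q != 0 -> x != 0 -> injective (fun j => x ^+ j) -> T \in pstensor nu ->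
    rank_le nu m (q *: T) ->
  exists D : tensor R d m, [/\ T + x *: D \in pstensor nu,
    rank_le nu m (q *: (T + x *: D)) &
    forall i, exists G : 'M[R]_(K, m),
      \det (flattening nu (T + x *: D) i *m G) != 0].
Proof.
move=> q0 x0 inj_x hT [c [l TE]].
pose y := q * x; have y0 : y != 0 by rewrite mulf_neq0.
pose L i : 'M[R]_m := \matrix_s l s i.
have detL i : exists j, \det ((y * x ^+ j)%:M + L i) != 0.
  by apply: exists_det_neq0 => j j' /(mulfI y0)/inj_x.
pose L' i := (y * x ^+ projT1 (cid (detL i)))%:M + L i.
have detL' i : \det (L' i) != 0 by exact: projT2 (cid (detL i)).
pose c' s := if c s == 0 then y else c s.
have c'0 s : c' s != 0 by rewrite /c'; case: (eqVneq (c s) 0).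
pose Y := diag_tensor nu c'.
have hY : Y \in pstensor nu by exact: pstensor_diag.
(* The perturbed decomposition is the image of a diagonal tensor by [L']. *)
have [D DE] : eq_upto y (q *: T) (induced L' Y).
  rewrite TE induced_diag; apply: eq_upto_sum => s.
  rewrite -!mul_mpolyC; apply: eq_uptoM.
    rewrite /c'; case: eqP => [->|_]; last exact: eq_upto_refl.
    by exists 1; rewrite mpolyC0 add0r -mul_mpolyC mulr1.
  apply: eq_upto_prod => i; apply: eq_uptoX.
  exists (lin i (row s (x ^+ projT1 (cid (detL i)))%:M)).
  rewrite -linearZ -linearD; congr (lin i _); apply/rowP => j.
  by rewrite !mxE addrC mulrnAr.
have qTE : q *: (T + x *: D) = induced L' Y by rewrite scalerDr scalerA DE.
have hT' : T + x *: D \in pstensor nu.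
  apply: (pstensorZ_inv q0); rewrite qTE; exact: pstensor_induced.
exists D; split=> //.
  by rewrite qTE induced_diag; exists c', (fun s i => row s (L' i)).
move=> i; have [G0 detG0] := nondeg_diag nu_neq0 nu_ge2 i c'0.
pose adj i := \adj (L' i).
pose g := \prod_(i < d) \det (L' i) ^+ nu i.
have g0 : g != 0 by apply/prodf_neq0 => i' _; rewrite expf_neq0.
exists (induced_mx nu adj *m G0).
have E : g *: (flattening nu Y i *m G0) =
    q *: ((adj i)^T *m (flattening nu (T + x *: D) i *m (induced_mx nu adj *m G0))).
  rewrite [LHS]scalemxAl -flatteningZ -(induced_adjugate _ hY) -qTE.
  rewrite flattening_induced ?pstensorZ // flatteningZ.
  by rewrite -scalemxAr -!scalemxAl !mulmxA.
have := congr1 determinant E; rewrite !detZ det_mulmx => {}E.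
have : g ^+ m * \det (flattening nu Y i *m G0) != 0.
  by rewrite mulf_neq0 // expf_neq0.
by rewrite E; apply: contraNneq => ->; rewrite !mulr0.
Qed.

End Perturb.

(** * Termination and minimal border rank *)

Lemma is_restriction_refl (R : comNzRingType) d m (T : tensor R d m) :
  is_restriction T T.
Proof. by exists (fun=> 1%:M); rewrite induced1. Qed.

Lemma is_restriction_trans (R : comNzRingType) d m (T T' T'' : tensor R d m) :
  is_restriction T T' -> is_restriction T' T'' -> is_restriction T T''.
Proof.
move=> [phi <-] [psi <-]; exists (fun i => psi i *m phi i).
by rewrite induced_comp.
Qed.

Lemma ltn_sum_gap d m (r r' : 'I_d -> nat) i :
  (forall i, r i <= r' i)%N -> (forall i, r' i <= m)%N -> r' i != r i ->
  (\sum_(i < d) (m - r' i) < \sum_(i < d) (m - r i))%N.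
Proof.
move=> le_r le_m ne; rewrite (bigD1 i) //= [ltnRHS](bigD1 i) //= -addSn.
apply: leq_add; last by apply: leq_sum => i' _; apply: leq_sub2l.
have lt : (r i < r' i)%N by rewrite ltn_neqAle eq_sym ne le_r.
by apply: ltn_sub2l => //; apply: leq_trans lt (le_m i).
Qed.

Section FractionFieldMatrix.
Variables (A : idomainType) (K : fieldType) (f : {rmorphism A -> K}).
Hypothesis f_inj : injective f.

(** Over the fraction field the determinant is a unit, so that [M] has full row
    rank there. *)
Lemma det_neq0_row_free m n (M : 'M[A]_(m, n)) G :
  \det (M *m G) != 0 -> row_free (map_mx f M).
Proof.
move=> h; rewrite /row_free eqn_leq rank_leq_row /=.
have : map_mx f (M *m G) \in unitmx by rewrite unitmxE det_map_mx unitfE raddf_eq0.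
rewrite map_mxM => /mxrank_unit {1}<-; exact: mxrankM_maxl.
Qed.

Hypothesis f_denom : forall (I : finType) (x : I -> K),
  exists2 q : A, q != 0 & exists n : I -> A, forall i, f q * x i = f (n i).

Lemma row_free_det_neq0 m n (M : 'M[A]_(m, n)) :
  row_free (map_mx f M) -> exists G, \det (M *m G) != 0.
Proof.
move=> free; pose G := pinvmx (map_mx f M).
have [q q0 [x xE]] := f_denom (fun s : 'I_n * 'I_m => G s.1 s.2).
exists (\matrix_(b, j) x (b, j)).
suff -> : M *m \matrix_(b, j) x (b, j) = q%:M.
  by rewrite det_scalar expf_neq0.
suff E : map_mx f (M *m \matrix_(b, j) x (b, j)) = map_mx f q%:M.
  by apply/matrixP => a b; apply: f_inj; have /matrixP/(_ a b) := E; rewrite !mxE.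
rewrite map_mxM map_scalar_mx /=.
have -> : map_mx f (\matrix_(b, j) x (b, j)) = f q *: G.
  by apply/matrixP => b j; rewrite [LHS]mxE [X in f X]mxE [RHS]mxE; symmetry; exact: (xE (b, j)).
by rewrite -scalemxAr mulmxVp // scalemx1.
Qed.

End FractionFieldMatrix.

Section BorderRank.
Variables (k : fieldType) (d m : nat) (nu : 'I_d -> nat).
Hypothesis regk : regular_exponents k nu.
Hypothesis nu_gt0 : forall i, (0 < nu i)%N.
Local Notation A := (pseries k).
Local Notation K := #|{: 'X_{1..(nvars d m) < \sum_(i < d) nu i}}|.
Local Notation span_rank T := (fun i => \rank (span_mx nu T i)).

Implicit Types T : tensor k d m.

Lemma tofrac_inj : injective (@tofrac A).
Proof. by move=> x y /eqP; rewrite tofrac_eq => /eqP. Qed.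

Lemma flattening_general (Tt : tensor A d m) i :
  flattening nu (general Tt) i = map_mx (@tofrac A) (flattening nu Tt i).
Proof. exact: flattening_map. Qed.

Lemma nondeg_of_det (Tt : tensor A d m) :
    (forall i, exists G : 'M[A]_(K, m), \det (flattening nu Tt i *m G) != 0) ->
  exists n, nondeg_at nu Tt n.
Proof.
move=> h; have P0 : \prod_(i < d) \det (flattening nu Tt i *m projT1 (cid (h i))) != 0.
  by apply/prodf_neq0 => i _; exact: projT2 (cid (h i)).
have [n Pn] := pscoef_neq0 P0; exists n, (fun i => projT1 (cid (h i))); exact: Pn.
Qed.

Lemma nondeg_general (Tt : tensor A d m) : Tt \in pstensor nu ->
  concise nu (general Tt) -> exists n, nondeg_at nu Tt n.
Proof.
move=> hTt cTt; apply: nondeg_of_det => i.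
apply: (row_free_det_neq0 tofrac_inj (@common_denominator A)).
rewrite -flattening_general.
apply: concise_row_free cTt => //.
- exact: regular_exponents_laurent.
- exact: (pstensor_map (@tofrac A)).
Qed.

(** Lower semicontinuity of the rank of a flattening: a right inverse of the
    flattening of the limit gives a determinant which is [1] at [t = 0]. *)
Lemma border_rank_lower T r (i : 'I_d) : row_free (flattening nu T i) ->
  border_rank_le nu r T -> (m <= r)%N.
Proof.
move=> /mulmxVp FG [Tt [_ limTt /(rank_flattening i) le_r]].
apply: leq_trans le_r; rewrite flattening_general.
set G := pinvmx _ in FG.
have E : ps_eval0 (\det (flattening nu Tt i *m map_mx (@ps_const k) G)) = 1.
  rewrite -det_map_mx map_mxM -flattening_map -limitE limTt map_eval0_const FG.
  exact: det1.
have detG : \det (flattening nu Tt i *m map_mx (@ps_const k) G) != 0.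
  by apply/eqP => h; have := oner_neq0 k; rewrite -E h raddf0 eqxx.
have /eqP fr := det_neq0_row_free tofrac_inj detG.
by rewrite fr.
Qed.

Lemma row_free_minimal (i : 'I_d) (Tt : tensor A d m) : Tt \in pstensor nu ->
    rank_le nu m (general Tt) ->
    (forall i, span_rank (limit Tt) i = m) ->
  minimal_border_rank nu (limit Tt).
Proof.
move=> hTt rkTt full; have hT := pstensor_limit hTt.
have free i' : row_free (flattening nu (limit Tt) i').
  by rewrite /row_free -(rank_span_mx regk i' hT); apply/eqP/full.
split; first exact: row_free_concise.
split; first by exists Tt.
move=> r; exact: border_rank_lower (free i).
Qed.

(** Induction on the total codimension of the [W i] and, for a fixed
    codimension, on the degree of the nondegeneracy witness. *)
Lemma iter_step N n (Tt : tensor A d m) : Tt \in pstensor nu ->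
    rank_le nu m (general Tt) -> nondeg_at nu Tt n ->
    (\sum_(i < d) (m - span_rank (limit Tt) i) <= N)%N ->
  exists s, [/\ iter s (unrestriction_step nu) Tt \in pstensor nu,
    rank_le nu m (general (iter s (unrestriction_step nu) Tt)),
    is_restriction (limit Tt) (limit (iter s (unrestriction_step nu) Tt)) &
    forall i, span_rank (limit (iter s (unrestriction_step nu) Tt)) i = m].
Proof.
elim: N n Tt => [|N IHN] n; elim/ltn_ind: n => n IHn Tt hTt rkTt nd gap.
  exists 0%N; split; [exact: hTt | exact: rkTt | exact: is_restriction_refl |].
  move=> i; move: gap; rewrite leqn0 sum_nat_eq0 => /forallP/(_ i)/implyP/(_ isT).
  by rewrite subn_eq0 => le; apply/eqP; rewrite eqn_leq rank_leq_row le.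
have [/existsP[i ri]|/existsPn full] := boolP [exists i, (span_rank (limit Tt) i < m)%N];
  last first.
  exists 0%N; split; [exact: hTt | exact: rkTt | exact: is_restriction_refl |].
  by move=> i; apply/eqP; rewrite eqn_leq rank_leq_row leqNgt full.
have [hTt' res le_r rk' nd'] := step_progress regk hTt (unrestriction_stepP regk hTt).
have {nd'} [n' nd' lt_n'] := nd' n nd.
move: hTt' res le_r rk' nd' lt_n'.
set Tt' := unrestriction_step nu Tt => hTt' res le_r rk' nd' lt_n'.
suff [s [h1 h2 h3 h4]] : exists s,
   [/\ iter s (unrestriction_step nu) Tt' \in pstensor nu,
    rank_le nu m (general (iter s (unrestriction_step nu) Tt')),
    is_restriction (limit Tt') (limit (iter s (unrestriction_step nu) Tt')) &
    forall i, span_rank (limit (iter s (unrestriction_step nu) Tt')) i = m].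
  exists s.+1; rewrite iterSr -/Tt'; split; [exact: h1|exact: h2| |exact: h4].
  exact: is_restriction_trans res h3.
have [stag|/forallPn[i' ne]] :=
  boolP [forall i, span_rank (limit Tt') i == span_rank (limit Tt) i].
  have E i' : span_rank (limit Tt') i' = span_rank (limit Tt) i'.
    exact/eqP/(forallP stag i').
  apply: (IHn n' (lt_n' i ri E) Tt' hTt' (rk' _ rkTt) nd').
  by under eq_bigr => i' _ do rewrite E.
apply: (IHN n' Tt' hTt' (rk' _ rkTt) nd').
rewrite -ltnS; apply: leq_trans gap.
apply: (ltn_sum_gap (i := i') le_r _ ne) => j; exact: rank_leq_row.
Qed.

Lemma unrestriction_minimal (i : 'I_d) n (Tt : tensor A d m) :
    Tt \in pstensor nu -> rank_le nu m (general Tt) -> nondeg_at nu Tt n ->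
  exists s,
    [/\ unrestriction nu s Tt \in pstensor nu,
        minimal_border_rank nu (unrestriction nu s Tt) &
        is_restriction (limit Tt) (unrestriction nu s Tt)].
Proof.
move=> hTt rkTt nd; have [s [h1 h2 h3 h4]] := iter_step hTt rkTt nd (leqnn _).
exists s; split; [exact: pstensor_limit h1 | | exact: h3].
exact: row_free_minimal i _ h1 h2 h4.
Qed.

(** The sum is [1] only when there is one space and no symmetric power, so that
    tensors are vectors. *)
Lemma rank_le1_linear T : (\sum_(i < d) nu i = 1)%N -> T \in pstensor nu ->
  rank_le nu 1 T.
Proof.
move=> N1 hT; have [i0 _] : exists i : 'I_d, true.
  apply/existsP; apply: contra_eqT N1 => /existsPn no; rewrite big1 // => i _.
  by have := no i.
have only i : i = i0.
  apply/eqP/negPn/negP => ne; move: N1; rewrite (bigD1 i0) //= (bigD1 i) //=.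
  by have := nu_gt0 i; have := nu_gt0 i0; case: (nu i0) => //; case: (nu i) => // a b; rewrite addSn addnS.
have nu1 : nu i0 = 1%N.
  by rewrite -N1 (bigD1 i0) //= big1 ?addn0 // => i; rewrite (only i) eqxx.
exists (fun=> 1), (fun _ i => \row_j T@_(U_(vx i j))).
rewrite big_ord1 scale1r (bigD1 i0) //= big1 ?mulr1 => [|i]; last first.
  by rewrite (only i) eqxx.
rewrite nu1 expr1; apply/mpolyP => a.
rewrite /lin raddf_sum /=; under eq_bigr do rewrite mcoeffZ mxE mcoeffX.
have [a1|a1] := boolP (mdeg a == 1%N).
  move/mdeg1P: a1 => [v /eqP ->]; rewrite -(vx_enum_val v) (only (enum_val v).1).
  rewrite (bigD1 (enum_val v).2) //= eqxx mulr1 big1 ?addr0 // => j ne.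
  by rewrite eq_mnm1 vx_eq (negPf ne) andbF mulr0.
have -> : T@_a = 0.
  by apply/eqP/contraT => /(pstensor_mdeg hT) E; rewrite E N1 in a1.
rewrite big1 // => j _; case: eqP => [e|]; last by rewrite mulr0.
by rewrite -e mdeg1 in a1.
Qed.

Lemma row_free_small T i : (m <= 1)%N -> T \in pstensor nu ->
  (m = 1%N -> T != 0) -> row_free (flattening nu T i).
Proof.
move=> m1 hT T0; rewrite -kermx_eq0; apply/negPn/negP => /rowV0Pn[f].
rewrite sub_kermx => /eqP/(contract_eq0 _ _ hT) fT f0.
have [j0 _|m0] := pickP (@predT 'I_m); last first.
  by case/eqP: f0; apply/rowP => j; have := m0 j.
have mE : m = 1%N by apply/eqP; rewrite eqn_leq m1 (leq_ltn_trans _ (ltn_ord j0)).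
have only (j : 'I_m) : j = j0.
  apply/val_inj => /=; have := leq_trans (ltn_ord j0) m1.
  have := leq_trans (ltn_ord j) m1.
  by rewrite !ltnS !leqn0 => /eqP -> /eqP ->.
have fj0 : f 0 j0 != 0.
  by apply: contraNneq f0 => h; apply/eqP/rowP => j; rewrite (only j) h mxE.
have dT : T^`M(vx i j0) = 0.
  move: fT; rewrite /contract (bigD1 j0) //= big1 ?addr0 => [|j]; last first.
    by rewrite (only j) eqxx.
  by move/eqP; rewrite -mul_mpolyC mulf_eq0 mpolyC_eq0 (negPf fj0) => /eqP.
case/eqP: (T0 mE); apply/mpolyP => a; rewrite mcoeff0.
apply/eqP/contraT => Ta; have := pstensorP _ _ hT _ Ta i.
rewrite (bigD1 j0) //= big1 ?addn0 => [E|j]; last by rewrite (only j) eqxx.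
by rewrite (mcoeff_mderiv_eq0 regk hT dT) ?eqxx // E in Ta.
Qed.

Lemma border_rank_le_rank r T : T \in pstensor nu -> rank_le nu r T ->
  border_rank_le nu r T.
Proof.
move=> hT rkT; exists (map_mpoly (@ps_const k) T); split.
- exact: pstensor_map.
- apply/mpolyP => a; rewrite mcoeff_limit mcoeff_map_mpoly; exact: erefl.
- by apply: (rank_le_map (@tofrac A)); apply: rank_le_map.
Qed.

End BorderRank.

Section ConciseDegeneration.
Variables (k : fieldType) (d m : nat) (nu : 'I_d -> nat).
Hypothesis regk : regular_exponents k nu.
Hypothesis nu_gt0 : forall i, (0 < nu i)%N.
Local Notation A := (pseries k).

(** The perturbation is a multiple of [t], so the limit is unchanged. *)
Lemma concise_degeneration (T : tensor k d m) :
    (1 < \sum_(i < d) nu i)%N -> border_rank_le nu m T ->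
  exists (Tt : tensor A d m) n, [/\ Tt \in pstensor nu, limit Tt = T,
    rank_le nu m (general Tt) & nondeg_at nu Tt n].
Proof.
move=> nu_ge2 [Tt [hTt limTt /rank_le_general[q q0 rkTt]]].
have nuA i : (nu i)%:R != 0 :> A.
  apply/eqP => /(congr1 (@ps_eval0 k)); rewrite rmorph_nat raddf0.
  by apply/eqP/(regk (i := i)); rewrite nu_gt0 leqnn.
have X0 : psX k != 0 by exact: (psXn_neq0 k 1).
have [D [hT' rkT' det_neq0]] :=
  perturb_nondegenerate nuA nu_ge2 q0 X0 (@psXn_inj k) hTt rkTt.
have [n nd] := nondeg_of_det det_neq0.
exists (Tt + psX k *: D), n; split; [exact: hT' | | | exact: nd].
  apply/mpolyP => a; rewrite mcoeff_limit mcoeffD mcoeffZ -limTt mcoeff_limit.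
  have -> : (Tt@_a + psX k * D@_a) 0%N = Tt@_a 0%N + (psX k * D@_a) 0%N by [].
  by rewrite pscoef_XM addr0.
by apply/rank_le_general; exists q.
Qed.
End ConciseDegeneration.

Theorem theorem2p2 (k : fieldType) (d m : nat) (nu : 'I_d -> nat)
    (d_gt0 : (0 < d)%N) (nu_gt0 : forall i, (0 < nu i)%N)
    (char_k : forall p, p \in [pchar k] -> forall i, (nu i < p)%N) :
  (forall T : tensor k d m,
     T \in pstensor nu -> has_border_rank nu T m ->
     exists T' : tensor k d m,
       [/\ T' \in pstensor nu, minimal_border_rank nu T' &
           is_restriction T T']) /\
  (forall Tt : tensor (pseries k) d m,
     Tt \in pstensor nu ->
     concise nu (general Tt) -> has_rank nu (general Tt) m ->
     exists n : nat,
       [/\ unrestriction nu n Tt \in pstensor nu,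
           minimal_border_rank nu (unrestriction nu n Tt) &
           is_restriction (limit Tt) (unrestriction nu n Tt)]).
Proof.
have regk := regular_exponents_char char_k; pose i0 := Ordinal d_gt0.
split=> [T hT brT | Tt hTt cTt [rkTt _]]; last first.
  have [n nd] := nondeg_general regk nu_gt0 hTt cTt.
  exact (unrestriction_minimal regk i0 hTt rkTt nd).
have [m_le1|m_gt1] := leqP m 1.
  exists T; split; [exact: hT | split; [|exact: brT] | exact: is_restriction_refl].
  apply: (row_free_concise hT) => i; apply: (row_free_small regk nu_gt0 i m_le1 hT) => m1.
  apply/eqP => T0; have : border_rank_le nu 0 T.
    apply: (border_rank_le_rank hT); exists (fun=> 0), (fun _ _ => 0).
    by rewrite T0 big_ord0.
  by move/(proj2 brT); rewrite m1.
have nu_ge2 : (1 < \sum_(i < d) nu i)%N.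
  rewrite ltn_neqAle eq_sym; apply/andP; split; last first.
    by rewrite (bigD1 i0) //= (leq_trans (nu_gt0 i0)) // leq_addr.
  apply/eqP => N1; move: m_gt1; rewrite ltnNge (proj2 brT) //.
  exact: border_rank_le_rank hT (rank_le1_linear nu_gt0 N1 hT).
have [Tt [n [hTt limTt rkTt nd]]] := concise_degeneration regk nu_gt0 nu_ge2 (proj1 brT).
have [s [h1 h2 h3]] := unrestriction_minimal regk i0 hTt rkTt nd.
exists (unrestriction nu s Tt); split; [exact: h1 | exact: h2 |].
by rewrite -limTt.
Qed.
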